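(* There is a positive constant $L=L(\|f_1\|_{L^q(\Omega)},q,C,\underline\kappa)$, continuous and nondecreasing with respect to $\|f_1\|_{L^q(\Omega)}$ and independent of $\delta$, with the following property. Let $\delta\in(0,\overline\delta)$, let $\kappa\in\mathbb{A}_\delta$ be arbitrary, let $f_1,f_2\in L^q(\Omega)$ with $\|f_2-f_1\|_{L^q(\Omega)}<1$, and let $\sigma_1\in\mathbb{Q}_\delta(f_1)$ and $\sigma_2\in\mathbb{Q}_\delta(f_2)$ be the unique minimizers of $\hat I_\delta(\kappa;\cdot)$ over $\mathbb{Q}_\delta(f_1)$ and $\mathbb{Q}_\delta(f_2)$ respectively. Then $$\hat I_\delta(\kappa;\sigma_2)\le\hat I_\delta(\kappa;\sigma_1)+L\,\|f_2-f_1\|_{L^q(\Omega)}.$$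
   Context: Fix an integer $n\ge 2$, exponents $1<p<\infty$ and $q$ with $1/p+1/q=1$, and a connected bounded open Lipschitz domain $\Omega\subset\mathbb{R}^n$. Kernels. For $\delta>0$ let $\Omega_\delta=\bigcup_{x\in\Omega}B(x,\delta)$, and let $\omega_\delta:\mathbb{R}^n\to[0,\infty)$ be a radial kernel supported in $B(0,\delta)$ with $\int_{\mathbb{R}^n}|x|^p\omega_\delta^p(x)\,dx=K_{p,n}^{-1}$, where $K_{p,n}=|\mathbb{S}^{n-1}|^{-1}\int_{\mathbb{S}^{n-1}}|e\cdot s|^p\,ds$ ($e\in\mathbb{S}^{n-1}$ arbitrary). Nonlocal gradient. Functions are extended by zero outside their explicit domain of definition. For $u\in L^p(\Omega)$ put $\mathcal{G}_\delta u(x,x')=[u(x)-u(x')]\omega_\delta(x-x')$, and $\mathbb{U}_{\delta,0}=\{u\in L^p(\Omega):\mathcal{G}_\delta u\in L^p(\Omega_\delta\times\Omega_\delta)\}$, which is dense in $L^p(\Omega)$. The constants $\overline{\delta}>0$, $C>0$ are such that $\|u\|_{L^p(\Omega)}\le C\|\mathcal{G}_\delta u\|_{L^p(\Omega_\delta\times\Omega_\delta)}$ for all $u\in\mathbb{U}_{\delta,0}$, $\delta\in(0,\overline\delta)$ (such constants exist by the known nonlocal Poincaré inequality). Nonlocal divergence. $\mathcal{D}_\delta:\mathbb{Q}_\delta=D(\mathcal{D}_\delta)\subset L^q(\Omega_\delta\times\Omega_\delta)\to L^q(\Omega)$ is the negative adjoint of $\mathcal{G}_\delta$: $\sigma\in\mathbb{Q}_\delta$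 iff there is $g=:\mathcal{D}_\delta\sigma\in L^q(\Omega)$ with $\int_\Omega g u\,dx=-\int_{\Omega_\delta}\int_{\Omega_\delta}\sigma\,\mathcal{G}_\delta u\,dx\,dx'$ for all $u\in\mathbb{U}_{\delta,0}$. Put $\mathbb{Q}_\delta(f)=\{\sigma\in\mathbb{Q}_\delta:\mathcal{D}_\delta\sigma=f\}$. Conductivities. $\mathbb{A}_\delta\subset L^\infty(\Omega_\delta\times\Omega_\delta)$ is a nonempty, convex, weakly$^*$ compact set such that every $\kappa\in\mathbb{A}_\delta$ satisfies $\underline\kappa\le\kappa(x,x')\le\overline\kappa$ and $\kappa(x,x')=\kappa(x',x)$ for a.e. $(x,x')$, with fixed constants $0<\underline\kappa\le\overline\kappa<\infty$ (independent of $\delta$). Energy. $\hat I_\delta(\kappa;\sigma)=\frac1q\int_{\Omega_\delta}\int_{\Omega_\delta}\kappa^{1-q}(x,x')|\sigma(x,x')|^q\,dx\,dx'$. For each $\delta\in(0,\overline\delta)$, $f\in L^q(\Omega)$, $\kappa\in\mathbb{A}_\delta$ it has a unique minimizer over $\mathbb{Q}_\delta(f)$. *)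

(* Defs.v *)
From HB Require Import structures.
From mathcomp Require Import all_boot all_order all_algebra.
From mathcomp Require Import all_classical all_reals all_analysis.
From mathcomp Require Import measurable_realfun.

Set Implicit Arguments.
Unset Strict Implicit.
Unset Printing Implicit Defensive.

Import Order.TTheory GRing.Theory Num.Theory.
Import numFieldNormedType.Exports.

Local Open Scope classical_set_scope.
Local Open Scope ring_scope.

Fact rV_display : measure_display. Proof. exact: default_measure_display. Qed.

Section measurable_rV.
Context {R : realType} {n : nat}.

Let coords (i : 'I_n) (x : 'rV[R]_n) : R := x ord0 i.

Let rV_set0 : g_sigma_preimage coords set0.
Proof. exact: sigma_algebra0. Qed.

Let rV_setC A : g_sigma_preimage coords A -> g_sigma_preimage coords (~` A).
Proof. exact: sigma_algebraC. Qed.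

Let rV_bigcup (F : _^nat) : (forall i, g_sigma_preimage coords (F i)) ->
  g_sigma_preimage coords (\bigcup_i (F i)).
Proof. exact: sigma_algebra_bigcup. Qed.

(* The product of the Borel sigma-algebras of the coordinates, which is the
   Borel sigma-algebra of 'rV[R]_n. *)
HB.instance Definition _ := @isMeasurable.Build rV_display
  'rV[R]_n (g_sigma_preimage coords) rV_set0 rV_setC rV_bigcup.

Lemma measurable_coord (i : 'I_n) :
  measurable_fun [set: 'rV[R]_n] (fun x : 'rV[R]_n => x ord0 i).
Proof.
move=> _ Y mY; rewrite setTI; apply: sub_sigma_algebra => /=.
rewrite -bigcup_seq/=; exists i => /=; first by rewrite mem_index_enum.
by exists Y => //; rewrite setTI.
Qed.

Lemma measurable_fun_rVP d (T : measurableType d) (f : T -> 'rV[R]_n) :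
  (forall i, measurable_fun [set: T] (fun x => f x ord0 i)) ->
  measurable_fun [set: T] f.
Proof.
move=> mf _ A mA; rewrite setTI.
have : preimage_set_system [set: T] f (g_sigma_preimage coords) (f @^-1` A).
  by exists A => //; rewrite setTI.
rewrite -g_sigma_preimage_comp.
apply: smallest_sub; first exact: sigma_algebra_measurable.
rewrite -bigcup_seq; apply: bigcup_sub => i _.
by move=> B [C mC <-]; exact: mf.
Qed.

End measurable_rV.

Section lebesgue_rV_step.
Context {R : realType} {n : nat}.
Variable m : {sigma_finite_measure set 'rV[R]_n -> \bar R}.

Definition cons_rV (tx : R * 'rV[R]_n) : 'rV[R]_n.+1 :=
  \row_i (if unlift ord0 i is Some j then tx.2 ord0 j else tx.1).

Let uncons_rV (x : 'rV[R]_n.+1) : R * 'rV[R]_n :=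
  (x ord0 ord0, \row_j x ord0 (lift ord0 j)).

Let cons0 tx : cons_rV tx ord0 ord0 = tx.1.
Proof. by rewrite mxE unlift_none. Qed.

Let consS tx j : cons_rV tx ord0 (lift ord0 j) = tx.2 ord0 j.
Proof. by rewrite mxE liftK. Qed.

Lemma measurable_cons_rV : measurable_fun [set: R * 'rV[R]_n] cons_rV.
Proof.
apply: measurable_fun_rVP => i.
case: (unliftP ord0 i) => [j|] ->.
- rewrite (_ : (fun _ => _) = (fun x : 'rV[R]_n => x ord0 j) \o snd).
    exact: measurableT_comp (measurable_coord j) measurable_snd.
  by apply/funext => tx; rewrite consS.
- rewrite (_ : (fun _ => _) = fst); first exact: measurable_fst.
  by apply/funext => tx; rewrite cons0.
Qed.

Let cons_rV_inj : injective cons_rV.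
Proof.
move=> [t x] [s y] E; congr (_, _).
- by have /(congr1 (fun v : 'rV[R]_n.+1 => v ord0 ord0)) := E; rewrite !cons0.
- apply/rowP => j.
  have /(congr1 (fun v : 'rV[R]_n.+1 => v ord0 (lift ord0 j))) := E.
  by rewrite !consS.
Qed.

Let measurable_uncons : measurable_fun setT uncons_rV.
Proof.
apply/measurable_fun_pair => /=; first exact: measurable_coord.
apply: measurable_fun_rVP => i.
rewrite (_ : (fun _ => _) = fun x : 'rV[R]_n.+1 => x ord0 (lift ord0 i)).
  exact: measurable_coord.
by apply/funext => x; rewrite mxE.
Qed.

Let uncons_rVK : cancel uncons_rV cons_rV.
Proof.
move=> x; apply/rowP => i; case: (unliftP ord0 i) => [j|] ->.
- by rewrite consS mxE.
- by rewrite cons0.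
Qed.

Let cons_rVK : cancel cons_rV uncons_rV.
Proof. by move=> tx; apply: cons_rV_inj; rewrite uncons_rVK. Qed.

Let prodm : {measure set (measurableTypeR R * 'rV[R]_n) -> \bar R} :=
  (@lebesgue_measure R \x m)%E.

Definition lebesgue_cons : set 'rV[R]_n.+1 -> \bar R :=
  pushforward prodm cons_rV.

Let mcons : measurable_fun [set: measurableTypeR R * 'rV[R]_n] cons_rV.
Proof. exact: measurable_cons_rV. Qed.

HB.instance Definition _ := Measure.copy lebesgue_cons
  (measure_function_pushforward__canonical__measure_function_Measure prodm mcons).

Let lebesgue_cons_sigma_finite : sigma_finite setT lebesgue_cons.
Proof.
have /sigma_finiteP[F [TF ndF Foo]] := sigma_finiteT (@lebesgue_measure R).
have /sigma_finiteP[G [TG ndG Goo]] := sigma_finiteT m.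
exists (fun k => uncons_rV @^-1` (F k `*` G k)).
  apply/seteqP; split => // x _.
  have : setT (uncons_rV x).1 by [].
  have : setT (uncons_rV x).2 by [].
  rewrite TF TG => -[l _ Gl] [k _ Fk]; exists (maxn k l) => //; split.
  - by move: Fk; exact/subsetPset/ndF/leq_maxl.
  - by move: Gl; exact/subsetPset/ndG/leq_maxr.
move=> k; have [mF Fk] := Foo k; have [mG Gk] := Goo k; split.
  rewrite -[X in measurable X]setTI.
  by apply: measurable_uncons => //; exact: measurableX.
rewrite /lebesgue_cons /pushforward -comp_preimage.
rewrite (_ : _ \o _ = id) ?preimage_id; last exact/funext.
by rewrite [ltLHS]product_measure1E// lte_mul_pinfty// ge0_fin_numE.
Qed.

HB.instance Definition _ := Measure_isSigmaFinite.Build _ _ _ lebesgue_cons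
  lebesgue_cons_sigma_finite.

End lebesgue_rV_step.

(* n-dimensional Lebesgue measure on the Borel sets, as the n-fold product of
   the one-dimensional one. *)
Fixpoint lebesgue_rV (R : realType) (n : nat) :
    {sigma_finite_measure set 'rV[R]_n -> \bar R} :=
  match n with
  | 0 => \d_(0 : 'rV[R]_0)
  | k.+1 => lebesgue_cons (lebesgue_rV R k)
  end.

Section euclidean.
Context {R : realType} {n : nat}.
Implicit Types (x y : 'rV[R]_n) (A : set 'rV[R]_n).

Definition dotv x y : R := \sum_(i < n) x ord0 i * y ord0 i.

(* The library norm on 'rV[R]_n is the sup norm. *)
Definition enorm x : R := Num.sqrt (dotv x x).

Definition eball x (r : R) : set 'rV[R]_n := [set y | enorm (y - x) < r].

Definition esphere : set 'rV[R]_n := [set x | enorm x = 1].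

(* Around each boundary point, the domain is the part lying above the graph of
   a Lipschitz function [h] over the hyperplane orthogonal to a unit vector
   [v] ([h] is only evaluated on that hyperplane). *)
Definition lipschitz_boundary A := forall x0, (closure A `\` interior A) x0 ->
  exists (r M : R) (v : 'rV[R]_n) (h : 'rV[R]_n -> R),
  [/\ 0 < r, enorm v = 1,
      (forall y z, dotv y v = 0 -> dotv z v = 0 ->
        `|h y - h z| <= M * enorm (y - z)) &
      forall x, eball x0 r x ->
        (A x <-> h (x - dotv x v *: v) < dotv x v)].

Definition lipschitz_domain A :=
  [/\ A !=set0, open A, connected A, bounded_set A & lipschitz_boundary A].

Lemma measurable_enorm : measurable_fun [set: 'rV[R]_n] enorm.
Proof.
apply: (measurableT_comp (f := @Num.sqrt R)).
  exact: (continuous_measurable_fun (@sqrt_continuous R)).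
apply: measurable_sum => i.
by apply: measurable_funM; exact: measurable_coord.
Qed.

Definition direction x : 'rV[R]_n := (enorm x)^-1 *: x.

Lemma measurable_direction : measurable_fun [set: 'rV[R]_n] direction.
Proof.
apply: measurable_fun_rVP => i.
rewrite (_ : (fun _ => _) = fun x : 'rV[R]_n => (enorm x)^-1 * x ord0 i).
  apply: measurable_funM; last exact: measurable_coord.
  rewrite (_ : (fun _ => _) = (@powR R ^~ (-1)) \o enorm).
    apply: measurableT_comp measurable_enorm.
    exact: measurable_powR.
  by apply/funext => x /=; rewrite powR_inv1// sqrtr_ge0.
by apply/funext => x; rewrite mxE.
Qed.

Lemma measurable_unit_eball : measurable (eball 0 1).
Proof.
rewrite (_ : eball 0 1 = enorm @^-1` `]-oo, 1[).
  by rewrite -[X in measurable X]setTI; exact: measurable_enorm.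
by apply/seteqP; split => x /=; rewrite /eball/= subr0 in_itv.
Qed.

(* Surface measure of the unit sphere: n times the Lebesgue measure of the
   cone over a subset of the sphere. It is carried by [esphere] up to the image
   [0] of the origin, which has measure zero. *)
Definition sphere_measure : set 'rV[R]_n -> \bar R :=
  pushforward
    (mscale n%:R%:nng (mrestr (lebesgue_rV R n) measurable_unit_eball))
    direction.

HB.instance Definition _ := Measure.copy sphere_measure
  (measure_function_pushforward__canonical__measure_function_Measure
    (mscale n%:R%:nng (mrestr (lebesgue_rV R n) measurable_unit_eball))
    measurable_direction).

Definition Kpn (p : R) (e : 'rV[R]_n) : R :=
  (fine (sphere_measure esphere))^-1 *
  \int[sphere_measure]_(s in esphere) (`|dotv e s| `^ p).

End euclidean.

Section lebesgue_space.
Context d (T : measurableType d) (R : realType).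
Variables (mu : {measure set T -> \bar R}) (D : set T).

(* L^p(D), through everywhere defined measurable representatives on the whole
   space that vanish outside D; functions are not identified a.e. *)
Definition Lp_on (p : \bar R) : set (T -> R) :=
  [set f | f \in Lfun mu p /\ forall x, ~ D x -> f x = 0].

Definition Linfty_pairing (k : T -> R) : {ptws Lp_on 1%E -> R} :=
  fun phi => \int[mu]_(x in D) (k x * \val phi x).

(* The coarsest topology making k |-> \int_D k * phi continuous for every phi
   in L^1(D); on L^oo(D) it is the weak-star topology. *)
Definition weak_star := initial_topology Linfty_pairing.

Definition weak_star_compact (A : set (T -> R)) :=
  compact (A : set weak_star).

End lebesgue_space.

Section nonlocal.
Context {R : realType} {n : nat}.
Local Notation V := 'rV[R]_n.
Local Notation leb := (lebesgue_rV R n).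

Definition leb2 : {measure set (V * V) -> \bar R} := (leb \x leb)%E.

Variables (Omega : set V) (p q : R).

Definition enlarge (delta : R) : set V :=
  \bigcup_(x in Omega) eball x delta.

Definition enlarge2 (delta : R) : set (V * V) :=
  enlarge delta `*` enlarge delta.

Definition is_kernel (e : V) (delta : R) (w : V -> R) :=
  [/\ measurable_fun setT w,
      forall x, 0 <= w x,
      forall x y, enorm x = enorm y -> w x = w y,
      forall x, ~ eball 0 delta x -> w x = 0 &
      (\int[leb]_x ((enorm x `^ p * w x `^ p)%:E) = ((Kpn p e)^-1)%:E)%E].

Variables (delta : R) (w : V -> R).

Definition nlgrad (u : V -> R) : V * V -> R :=
  (fun z => (u z.1 - u z.2) * w (z.1 - z.2)) \_ (enlarge2 delta).

Definition U0 : set (V -> R) :=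
  [set u | Lp_on leb Omega p%:E u /\
           Lp_on leb2 (enlarge2 delta) p%:E (nlgrad u)].

(* Graph of the nonlocal divergence: [sigma] belongs to its domain and is mapped
   to [g]. The function [g] is unique up to a.e. equality only. *)
Definition is_nldiv (sigma : V * V -> R) (g : V -> R) :=
  [/\ Lp_on leb2 (enlarge2 delta) q%:E sigma,
      Lp_on leb Omega q%:E g &
      forall u, U0 u -> \int[leb]_(x in Omega) (g x * u x) =
        - \int[leb2]_(z in enlarge2 delta) (sigma z * nlgrad u z)].

Definition Qf (f : V -> R) : set (V * V -> R) :=
  [set sigma | is_nldiv sigma f].

Definition energy (kappa sigma : V * V -> R) : \bar R :=
  ((q^-1)%:E * \int[leb2]_(z in enlarge2 delta)
     ((kappa z `^ (1 - q) * `|sigma z| `^ q)%:E))%E.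

Definition energy_minimizer (kappa : V * V -> R) (f : V -> R)
    (sigma : V * V -> R) :=
  Qf f sigma /\
  forall tau, Qf f tau -> (energy kappa sigma <= energy kappa tau)%E.

End nonlocal.

Definition poincare (R : realType) (n : nat) (Omega : set 'rV[R]_n) (p : R)
    (omega : R -> 'rV[R]_n -> R) (deltabar C : R) :=
  forall delta, 0 < delta < deltabar ->
  forall u, U0 Omega p delta (omega delta) u ->
  ('N[lebesgue_rV R n]_(p%:E)[EFin \o u] <=
   C%:E * 'N[leb2]_(p%:E)[EFin \o nlgrad Omega delta (omega delta) u])%E.

Definition conductivities (R : realType) (n : nat) (Omega : set 'rV[R]_n)
    (klow kup delta : R) (A : set ('rV[R]_n * 'rV[R]_n -> R)) :=
  [/\ A !=set0,
      A `<=` Lp_on leb2 (enlarge2 Omega delta) +oo%E,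
      convex_set (A : set ('rV[R]_n * 'rV[R]_n -> R^o)),
      weak_star_compact leb2 (enlarge2 Omega delta) A &
      forall kappa, A kappa ->
        {ae leb2, forall z, enlarge2 Omega delta z ->
          klow <= kappa z <= kup /\ kappa z = kappa (z.2, z.1)}].

(* Main.v *)
(* Duality.  Let [r] be the L^p limit of the gradients [G u_k] along a minimizing
   sequence of J(u) = 1/p int kappa |G u|^p + int f2 u.  The Euler-Lagrange
   equation says that sigma = kappa |r|^(p-2) r has divergence f2, so sigma
   competes with sigma2.  Young's inequality gives
     I(sigma) <= I(sigma1) + int r (sigma - sigma1),
   and the last integral is the limit of - int (f2 - f1) u_k, which the Poincare
   inequality bounds by C |f2 - f1|_q |r|_p.  Testing with [r] itself gives
   klow |r|_p^p <= C |f2|_q |r|_p, hence |r|_p <= (C (|f1|_q + 1) / klow)^(q-1).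
   Only the gradients need a limit, and Euler-Lagrange and the limit passages
   are done by dominated convergence, so no duality theory of L^p is used. *)
Require Import Defs.
From mathcomp Require Import all_boot all_order all_algebra.
From mathcomp Require Import all_classical all_reals all_analysis.
From mathcomp Require Import ring lra measurable_realfun.

Set Implicit Arguments.
Unset Strict Implicit.
Unset Printing Implicit Defensive.

Import Order.TTheory GRing.Theory Num.Theory.
Import numFieldNormedType.Exports.

Local Open Scope classical_set_scope.
Local Open Scope ring_scope.

(** * Power functions *)

(** The limit [r] is never shown to be a gradient itself, so whatever is tested with [r] must be
    inherited from the sequence. This is why the sequence is made to converge a.e. under an L^p
    majorant. Such convergence comes from a quantitative strict convexity of |x|^p, valid for all p
    > 1 at once: the midpoint of two near-minimizers cannot fall below the infimum, which forces
    their gradients to be close. The variational part is phrased for abstract pairs (g, l), which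
    stand for (G u, - int f2 u); it uses only linearity and |l| <= B |g|_p, and here B = C |f2|_q.
    The constant L contains C twice: once outside the power, from pairing f2 - f1 with u_k, and once
    inside it, from the bound on |r|_p. *)

Section powR_facts.
Context {R : realType}.
Implicit Types (a b k p q r s t x y : R).

(** Away from 0 this is a differentiable power composed with the norm; at 0 the radius [e ^ (1/s)]
    answers the tolerance [e]. *)
Lemma continuous_powR_norm s : 0 < s -> continuous (fun x => `|x| `^ s).
Proof.
move=> s0 x.
have [x0|x0] := eqVneq x 0; last first.
  apply: (@continuous_comp _ _ _ (fun y : R => `|y|) (fun y => y `^ s)).
    exact: norm_continuous.
  apply/differentiable_continuous/derivable1_diffP/derivable_powR.
  by rewrite in_itv/= andbT normr_gt0.
rewrite x0; suff : `|y| `^ s @[y --> (0 : R)] --> (0 : R).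
  by rewrite /continuous_at normr0 powR0 ?gt_eqF.
apply/cvgrPdist_lt => e e0; near=> y.
rewrite sub0r normrN ger0_norm ?powR_ge0//.
rewrite -[ltRHS]powRr1 ?ltW// -[X in _ < _ `^ X](mulVf (lt0r_neq0 s0)) powRrM.
rewrite gt0_ltr_powR// ?nnegrE ?powR_ge0//.
by near: y; apply/nbhs_normP; exists (e `^ s^-1) => [|z] /=;
  rewrite ?powR_gt0 ?sub0r ?normrN.
Unshelve. all: end_near. Qed.

(* [spow (p - 1)] is the derivative of [|x|^p / p], extended continuously *)
Definition spow s x : R := Num.max x 0 `^ s - Num.max (- x) 0 `^ s.

Lemma spow_ge0 s x : 0 < s -> 0 <= x -> spow s x = `|x| `^ s.
Proof.
move=> s0 x0; rewrite /spow max_l// max_r ?oppr_le0// powR0 ?gt_eqF// subr0.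
by rewrite ger0_norm.
Qed.

Lemma spow_le0 s x : 0 < s -> x <= 0 -> spow s x = - `|x| `^ s.
Proof.
move=> s0 x0; rewrite /spow max_r// max_l ?oppr_ge0// powR0 ?gt_eqF// sub0r.
by rewrite ler0_norm.
Qed.

Lemma norm_spow s x : 0 < s -> `|spow s x| = `|x| `^ s.
Proof.
move=> s0; have [x0|/ltW x0] := leP 0 x.
  by rewrite spow_ge0// ger0_norm// powR_ge0.
by rewrite spow_le0// normrN ger0_norm// powR_ge0.
Qed.

Lemma spowM s x : 0 < s -> spow s x * x = `|x| `^ (s + 1).
Proof.
move=> s0; have s1 : s = s + 1 - 1 by rewrite addrK.
have s10 : 0 < s + 1 by rewrite addr_gt0.
rewrite -(mulr_powRB1 (normr_ge0 x) s10) -s1 mulrC.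
have [x0|/ltW x0] := leP 0 x; first by rewrite spow_ge0// ger0_norm.
by rewrite spow_le0// mulrN [in RHS]ler0_norm// mulNr [in LHS]ler0_norm.
Qed.

Lemma continuous_spow s : 0 < s -> continuous (spow s).
Proof.
move=> s0 x.
have cmax (f : R -> R) : continuous f ->
    continuous (fun y => Num.max (f y) 0 `^ s).
  move=> cf y.
  rewrite (_ : (fun y => _) =
    (fun z => `|z| `^ s) \o (fun y => Num.max (f y) 0)).
    apply: continuous_comp; last exact: continuous_powR_norm.
    by apply: continuous_max => //; [exact: cf|exact: cst_continuous].
  by apply/funext => z /=; rewrite [`|_|]ger0_norm// le_max lexx orbT.
apply: cvgB; first by apply: (cmax id) => y; exact: cvg_id.
by apply: (cmax -%R); exact: opp_continuous.
Qed.

(** * Convexity inequalities for |x|^p *)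

Lemma strict_bernoulli p x : 1 < p -> 0 <= x -> x != 1 ->
  1 + p * (x - 1) < x `^ p.
Proof.
move=> p1; have p0 : 0 < p by lra.
rewrite le_eqVlt => /predU1P[<- _|x0 x1].
  by rewrite powR0 ?gt_eqF//; lra.
have lx : - ln x != 0 by rewrite oppr_eq0 ln_eq0.
have e1 : 1 - ln x < x^-1.
  by have := expR_gt1Dx lx; rewrite expRN lnK.
have e2 : 1 + (p - 1) * ln x <= x `^ (p - 1).
  by rewrite /powR gt_eqF//; exact: expR_ge1Dx.
rewrite -(mulr_powRB1 (ltW x0) p0) -subr_gt0.
set y := x `^ (p - 1) in e2 *.
rewrite (_ : _ - _ = x * ((y - (1 + (p - 1) * ln x)) +
  (p - 1) * (x^-1 - (1 - ln x)))); last first.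
  by field; rewrite gt_eqF.
by apply: mulr_gt0 => //; apply: ltr_wpDl; [lra | apply: mulr_gt0; lra].
Qed.

(** Bernoulli is applied at 1/m and s/m, where s = |t| and m = (1 + s)/2. These points average to 1,
    so the linear terms cancel, and multiplying by m^p gives the claim for s, hence for t. The value
    t = -1 stands apart: there m = 1 and Bernoulli is not strict. *)
Lemma strict_midpoint_powR p t : 1 < p -> `|t| <= 1 -> t < 1 ->
  `|(1 + t) / 2| `^ p < (1 + `|t| `^ p) / 2.
Proof.
move=> p1 t1 t1'; have p0 : 0 < p by lra.
have tm : -1 <= t by move: t1; rewrite ler_norml => /andP[].
rewrite (@ger0_norm _ ((1 + t) / 2)); last lra.
have [tE|tE] := eqVneq `|t| 1.
  have -> : t = -1.
    by move: tE; have [x0|x0] := leP 0 t; [rewrite ger0_norm|rewrite ltr0_norm]; lra.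
  by rewrite subrr mul0r powR0 ?gt_eqF// normrN normr1 powR1; lra.
have {tE} t2 : `|t| < 1 by rewrite lt_neqAle tE.
set s := `|t| in t1 t2 *; have s0 : 0 <= s := normr_ge0 t.
pose m := (1 + s) / 2; have m0 : 0 < m by rewrite /m; lra.
apply: (@le_lt_trans _ _ (m `^ p)).
  apply: ge0_ler_powR; rewrite ?nnegrE /m; [lra|lra|lra|].
  by have := ler_norm t; rewrite -/s; lra.
have m1 : m^-1 != 1 by rewrite invr_eq1 /m; apply/eqP; lra.
have sm1 : s / m != 1.
  apply/eqP => H; have : s = m by rewrite -[LHS](divfK (lt0r_neq0 m0)) H mul1r.
  rewrite /m; lra.
have im0 : 0 <= m^-1 by rewrite invr_ge0 ltW.
have E1 := strict_bernoulli p1 im0 m1.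
have E2 := strict_bernoulli p1 (mulr_ge0 s0 im0) sm1.
have E3 : 2 < m^-1 `^ p + (s / m) `^ p.
  apply: le_lt_trans (ltrD E1 E2).
  suff -> : s / m = 2 - m^-1 by lra.
  by rewrite /m; field; lra.
rewrite powRM// in E3.
have mp : m^-1 `^ p = (m `^ p)^-1.
  by rewrite -(powR_inv1 (ltW m0)) -(powR_inv1 (powR_ge0 m p)) powRAC.
rewrite mp in E3.
have mp0 : 0 < m `^ p by rewrite powR_gt0.
move: E3; rewrite -{1}(mul1r (_^-1)) -mulrDl ltr_pdivlMr//; lra.
Qed.

(** Homogeneity reduces to a = 1 and b = t in [-1, 1]. For t > 1 - h the [e] term suffices, because
    h^p <= e; on [-1, 1 - h] the convexity gap [phi] has a positive minimum by compactness, which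
    determines [K]. The [e] term is what admits p < 2, where near t = 1 the gap is of order (1 -
    t)^2, smaller than |1 - t|^p. *)
Lemma uniform_convexity_powR p (e : R) : 1 < p -> 0 < e ->
  exists2 K, 0 < K & forall a b, `|a - b| `^ p <=
    e * (`|a| `^ p + `|b| `^ p) +
    K * ((`|a| `^ p + `|b| `^ p) / 2 - `|(a + b) / 2| `^ p).
Proof.
move=> p1 e0; have p0 : 0 < p by lra.
pose phi t := (1 + `|t| `^ p) / 2 - `|(1 + t) / 2| `^ p.
have cphi : continuous phi.
  move=> t; apply: cvgB.
    apply: cvgMl; apply: cvgD; first exact: cvg_cst.
    exact: continuous_powR_norm.
  apply: (@continuous_comp _ _ _ (fun t => (1 + t) / 2) (fun z => `|z| `^ p)).
    by apply: cvgMl; apply: cvgD; [exact: cvg_cst|exact: cvg_id].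
  exact: continuous_powR_norm.
pose h := Num.min (e `^ p^-1) 1.
have h0 : 0 < h by rewrite lt_min powR_gt0//=.
have h1 : h <= 1 by rewrite ge_min lexx orbT.
have hp : h `^ p <= e.
  have -> : e = (e `^ p^-1) `^ p by rewrite -powRrM mulVf ?gt_eqF// powRr1 ?ltW.
  apply: ge0_ler_powR; rewrite ?nnegrE ?powR_ge0 ?(ltW p0) ?(ltW h0)//.
  by rewrite ge_min lexx.
have [c] := @EVT_min R phi (-1) (1 - h) ltac:(lra) (continuous_subspaceT cphi).
rewrite in_itv/= => /andP[c1 c2] cmin.
have phic : 0 < phi c.
  by rewrite subr_gt0 strict_midpoint_powR//; [rewrite ler_norml; lra|lra].
have phi_ge0 t : `|t| <= 1 -> 0 <= phi t.
  move=> t1; have [->|tE] := eqVneq t 1.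
    rewrite /phi normr1 powR1 (_ : (1 + 1) / 2 = 1); last by lra.
    by rewrite normr1 powR1 subrr.
  rewrite ltW// subr_gt0 strict_midpoint_powR//.
  by rewrite lt_neqAle tE (le_trans (ler_norm t)).
pose K := 2 `^ p / phi c.
have K0 : 0 < K by rewrite divr_gt0 ?powR_gt0.
have main t : `|t| <= 1 -> `|1 - t| `^ p <= e * (1 + `|t| `^ p) + K * phi t.
  move=> t1; have [tm tM] : -1 <= t /\ t <= 1 by apply/andP; rewrite -ler_norml.
  have tp := powR_ge0 `|t| p.
  have [th|th] := leP t (1 - h).
    apply: (@le_trans _ _ (2 `^ p)).
      by rewrite ge0_ler_powR ?nnegrE ?(ltW p0)// ger0_norm; lra.
    apply: (@le_trans _ _ (K * phi t)).
      by rewrite /K mulrAC ler_pdivlMr// ler_wpM2l ?powR_ge0// cmin// in_itv/= tm.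
    by rewrite lerDr mulr_ge0; lra.
  apply: (@le_trans _ _ e).
    apply: le_trans hp; rewrite ge0_ler_powR ?nnegrE ?(ltW p0) ?(ltW h0)//.
    by rewrite ger0_norm; lra.
  have := mulr_ge0 (ltW K0) (phi_ge0 t t1).
  have := mulr_ge0 (ltW e0) tp; lra.
have gen a b : `|b| <= `|a| -> `|a - b| `^ p <=
    e * (`|a| `^ p + `|b| `^ p) +
    K * ((`|a| `^ p + `|b| `^ p) / 2 - `|(a + b) / 2| `^ p).
  move=> ba; have [a0|a0] := eqVneq a 0.
    move: ba; rewrite a0 normr0 normr_le0 => /eqP ->.
    by rewrite subr0 addr0 mul0r normr0 powR0 ?gt_eqF//; lra.
  have ba1 : `|b / a| <= 1.
    by rewrite normrM normfV ler_pdivrMr ?normr_gt0// mul1r.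
  have E t : `|a * t| `^ p = `|a| `^ p * `|t| `^ p by rewrite normrM powRM.
  have -> : a - b = a * (1 - b / a) by field.
  have -> : (a + b) / 2 = a * ((1 + b / a) / 2) by field.
  rewrite -[in `|b| `^ p](divfK a0 b) (mulrC (b / a)) !E.
  have := ler_wpM2l (powR_ge0 `|a| p) (main _ ba1).
  by rewrite /phi; lra.
exists K => // a b; have [|/ltW] := leP `|b| `|a|; first exact: gen.
by move=> /gen; rewrite distrC [`|b| `^ p + _]addrC (addrC b).
Qed.

(** Convexity with the tangent taken at the displaced point [a + b]; it follows from Young for
    [spow (p - 1) (a + b) * a]. Once integrated, it bounds an increment of the energy without
    differentiation under the integral sign. *)
Lemma powR_norm_add_le p a b : 1 < p ->
  `|a + b| `^ p / p <= `|a| `^ p / p + spow (p - 1) (a + b) * b.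
Proof.
move=> p1; have p0 : 0 < p by lra.
have p10 : 0 < p - 1 by lra.
set c := a + b; rewrite (_ : b = c - a); last by rewrite /c addrAC subrr add0r.
rewrite mulrBr spowM// subrK.
have q0 : 0 < p / (p - 1) by rewrite divr_gt0.
have : spow (p - 1) c * a <= `|c| `^ p * (p - 1) / p + `|a| `^ p / p.
  apply: le_trans (ler_norm _) _; rewrite normrM norm_spow//.
  apply: le_trans (conjugate_powR (powR_ge0 _ _) (normr_ge0 a) q0 p0 _) _.
    by rewrite invf_div; field; rewrite gt_eqF.
  rewrite -powRrM (_ : (p - 1) * (p / (p - 1)) = p) ?invf_div ?mulrA//.
  by field; rewrite gt_eqF.
rewrite (_ : `|c| `^ p * (p - 1) / p = `|c| `^ p - `|c| `^ p / p); last first.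
  by field; rewrite gt_eqF.
lra.
Qed.

Lemma conjugate_gt1 p q : 1 < p -> p^-1 + q^-1 = 1 -> 1 < q.
Proof.
move=> p1 pq; have p0 : 0 < p by lra.
have ip : p^-1 < 1 by rewrite invf_lt1.
have ip0 : 0 < p^-1 by rewrite invr_gt0.
have iq : 0 < q^-1 by lra.
have q0 : 0 < q by rewrite -invr_gt0.
by rewrite -(invf_lt1 q0); lra.
Qed.

Lemma conjugate_subM p q : 1 < p -> p^-1 + q^-1 = 1 -> (p - 1) * q = p.
Proof.
move=> p1 pq; have q1 := conjugate_gt1 p1 pq.
have := congr1 ( *%R (p * q)) pq.
rewrite mulr1 (_ : p * q * _ = p + q); last by field; rewrite !gt_eqF//; lra.
by move=> E; rewrite mulrBl mul1r -E addrK.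
Qed.

(** The factor 1 is split as k^(1/p) k^(-1/p) before Young; since -q/p = 1 - q, the second term is
    the density of the dual energy. Equality holds at y = k [spow (p - 1) x]. *)
Lemma weighted_young p q k x y : 1 < p -> p^-1 + q^-1 = 1 -> 0 < k ->
  x * y <= k * `|x| `^ p / p + k `^ (1 - q) * `|y| `^ q / q.
Proof.
move=> p1 pq k0; have p0 : 0 < p by lra.
have q0 : 0 < q := lt_trans ltr01 (conjugate_gt1 p1 pq).
apply: le_trans (ler_norm _) _.
have kp : 0 < k `^ p^-1 by rewrite powR_gt0.
rewrite (_ : `|x * y| = (k `^ p^-1 * `|x|) * (k `^ (- p^-1) * `|y|)); last first.
  by rewrite powRN mulrACA divff ?gt_eqF// mul1r normrM.
apply: le_trans (conjugate_powR _ _ p0 q0 pq) _; rewrite ?mulr_ge0 ?powR_ge0//.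
rewrite !powRM ?powR_ge0// -!powRrM mulVf ?gt_eqF// powRr1 ?(ltW k0)//.
rewrite (_ : - p^-1 * q = 1 - q)//.
have -> : p^-1 = 1 - q^-1 by lra.
by field; rewrite gt_eqF.
Qed.

End powR_facts.

(** * L^p functions and dominated convergence *)

Section Lp_tools.
Context d (T : measurableType d) (R : realType).
Variable mu : {measure set T -> \bar R}.
Implicit Types (f g h r : T -> R) (p q : R).

Lemma Lfun_measurable (p : \bar R) f : f \in Lfun mu p -> measurable_fun setT f.
Proof. by rewrite inE => /andP[]; rewrite inE. Qed.

Lemma measurable_powR_norm p f : measurable_fun setT f ->
  measurable_fun setT (fun x => `|f x| `^ p).
Proof.
move=> mf; apply: measurableT_comp (measurable_powR _) _.
exact: measurableT_comp.
Qed.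

Lemma integrable_Lfun p f : 1 <= p -> measurable_fun setT f ->
  mu.-integrable setT (EFin \o (fun x => `|f x| `^ p)) -> f \in Lfun mu p%:E.
Proof.
move=> p1 mf /integrableP[_ ifoo].
rewrite inE; apply/andP; split; rewrite inE//= /finite_norm unlock.
apply: poweR_lty; apply: le_lt_trans ifoo; apply: ge0_le_integral => //=.
- by apply/measurable_EFinP; exact: measurable_powR_norm.
- by do 2 apply: measurableT_comp => //; exact: measurable_powR_norm.
- by move=> x _; rewrite lee_fin ler_norm.
Qed.

Lemma le_Lfun p f g : 1 <= p -> measurable_fun setT f -> g \in Lfun mu p%:E ->
  (forall x, `|f x| <= `|g x|) -> f \in Lfun mu p%:E.
Proof.
move=> p1 mf Lg fg; apply: integrable_Lfun => //.
apply: le_integrable (Lfun_integrable p1 Lg) => //.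
  by apply/measurable_EFinP; exact: measurable_powR_norm.
move=> x _; rewrite lee_fin !(ger0_norm (powR_ge0 _ _))//.
by apply: ge0_ler_powR; rewrite ?nnegrE//; exact: le_trans ler01 p1.
Qed.

Lemma LfunD p f g : 1 <= p -> f \in Lfun mu p%:E -> g \in Lfun mu p%:E ->
  (fun x => f x + g x) \in Lfun mu p%:E.
Proof. by move=> p1; have [_ +] := @Lfun_addr_closed _ T R mu p%:E p1; exact. Qed.

Lemma LfunZ p c f : 1 <= p -> f \in Lfun mu p%:E ->
  (fun x => c * f x) \in Lfun mu p%:E.
Proof.
move=> p1 Lf; rewrite (_ : (fun x => _) = c \o* f); first exact: Lfun_scale.
by apply/funext => x /=; rewrite mulrC.
Qed.

Lemma LfunB p f g : 1 <= p -> f \in Lfun mu p%:E -> g \in Lfun mu p%:E ->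
  (fun x => f x - g x) \in Lfun mu p%:E.
Proof.
move=> p1 Lf Lg; rewrite (_ : (fun x => _) = (fun x => f x + -1 * g x)).
  by apply: LfunD => //; exact: LfunZ.
by apply/funext => x; rewrite mulN1r.
Qed.

Lemma Lfun_fine_Lnorm p f : p != 0 -> f \in Lfun mu p%:E ->
  fine ('N[mu]_(p%:E)[EFin \o f])%E = (\int[mu]_x `|f x| `^ p) `^ p^-1.
Proof. by move=> p0 Lf; rewrite unlock fine_poweR. Qed.

Lemma Lfun_Lnorm_fin (p : \bar R) f : f \in Lfun mu p ->
  ('N[mu]_p[EFin \o f])%E \is a fin_num.
Proof.
by rewrite inE => /andP[_]; rewrite inE/= /finite_norm ge0_fin_numE// Lnorm_ge0.
Qed.

Lemma Lfun_mul_integrable p q f g : 1 < p -> p^-1 + q^-1 = 1 ->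
  f \in Lfun mu p%:E -> g \in Lfun mu q%:E ->
  mu.-integrable setT (EFin \o (fun x => f x * g x)).
Proof.
move=> p1 pq Lf Lg; have q1 := conjugate_gt1 p1 pq.
have [mf mg] := (Lfun_measurable Lf, Lfun_measurable Lg).
apply/integrableP; split.
  by apply/measurable_EFinP; exact: measurable_funM.
have := hoelder mu mf mg (lt_trans ltr01 p1) (lt_trans ltr01 q1) pq.
rewrite Lnorm1 => /le_lt_trans; apply.
rewrite lte_mul_pinfty ?Lnorm_ge0 ?Lfun_Lnorm_fin//.
by rewrite -ge0_fin_numE ?Lnorm_ge0// Lfun_Lnorm_fin.
Qed.

Lemma hoelder_Rintegral p q f g : 1 < p -> p^-1 + q^-1 = 1 ->
  f \in Lfun mu p%:E -> g \in Lfun mu q%:E ->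
  `|\int[mu]_x (f x * g x)| <=
  fine ('N[mu]_(p%:E)[EFin \o f])%E * fine ('N[mu]_(q%:E)[EFin \o g])%E.
Proof.
move=> p1 pq Lf Lg; have q1 := conjugate_gt1 p1 pq.
have [mf mg] := (Lfun_measurable Lf, Lfun_measurable Lg).
rewrite -lee_fin EFin_normr_Rintegral//; last exact: Lfun_mul_integrable p1 pq Lf Lg.
rewrite EFinM !fineK ?Lfun_Lnorm_fin//.
apply: le_trans (hoelder mu mf mg (lt_trans ltr01 p1) (lt_trans ltr01 q1) pq).
rewrite Lnorm1; apply: le_abse_integral => //.
by apply/measurable_EFinP; exact: measurable_funM.
Qed.

Lemma dominated_Rintegral (u : nat -> T -> R) f h :
  (forall n, measurable_fun setT (u n)) -> measurable_fun setT f ->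
  {ae mu, forall x, u ^~ x @ \oo --> f x} ->
  mu.-integrable setT (EFin \o h) ->
  {ae mu, forall x n, `|u n x| <= h x} ->
  \int[mu]_x u n x @[n --> \oo] --> \int[mu]_x f x.
Proof.
move=> mu_ mf uf ih uh.
have [||||| iF _ c] := @dominated_convergence _ T R mu setT measurableT
  (fun n => EFin \o u n) (EFin \o f) (EFin \o h).
- by move=> n; exact/measurable_EFinP.
- exact/measurable_EFinP.
- by apply: filterS uf => x ux _; apply/cvg_EFin => //; exact: nearW.
- by [].
- by apply: filterS uh => x ux n _; rewrite /= lee_fin.
- apply: fine_cvg; rewrite fineK; first exact: c.
  exact: integrable_fin_num.
Qed.

(** Takes the place of strong L^p convergence: with the majorant [h] in the definition, each limit
    passage below is one use of dominated convergence. *)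
Definition Lp_dominated_cvg p (g : nat -> T -> R) r :=
  [/\ forall k, g k \in Lfun mu p%:E, r \in Lfun mu p%:E &
      exists2 h, h \in Lfun mu p%:E &
      {ae mu, forall x, (forall k, `|g k x| <= h x) /\ g ^~ x @ \oo --> r x}].

End Lp_tools.

Lemma geometric_half_le2 (R : realType) n :
  series (geometric 1 (2^-1 : R)) n <= 2.
Proof.
apply: le_trans (geometric_le_lim n ler01 _ _) _; rewrite ?invr_gt0//.
  by rewrite ger0_norm; lra.
by rewrite le_eqVlt; apply/orP; left; apply/eqP; field.
Qed.

(** The explicit bound matters as much as the convergence: applied pointwise, it provides the L^p
    majorant. *)
Lemma geometric_bounded_increments (R : realType) (u : nat -> R) (c : R) :
  (forall k, `|u k.+1 - u k| <= c * 2^-1 ^+ k) ->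
  cvgn u /\ forall k, `|u k| <= `|u 0%N| + 2 * c.
Proof.
move=> uc; have c0 : 0 <= c.
  by have := uc 0%N; rewrite expr0 mulr1; apply: le_trans.
split.
  have : cvgn (series (telescope u)).
    apply: normed_cvg.
    apply: (@series_le_cvg _ _ (geometric c 2^-1)) => [n|n|n|].
    - exact: normr_ge0.
    - exact: geometric_ge0.
    - exact: uc.
    - by apply: is_cvg_geometric_series; rewrite ger0_norm; lra.
  rewrite telescopeK => cs.
  rewrite (_ : u = (fun n => (u n - u 0%N) + u 0%N)).
    by apply: is_cvgD => //; exact: is_cvg_cst.
  by apply/funext => n; rewrite subrK.
move=> k; rewrite {1}(eq_sum_telescope u k).
apply: le_trans (ler_normD _ _) _; rewrite lerD2l.
apply: le_trans (ler_norm_sum _ _ _) _.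
apply: (@le_trans _ _ (\sum_(0 <= i < k) c * 2^-1 ^+ i)).
  by apply: ler_sum => i _; exact: uc.
rewrite -mulr_sumr mulrC ler_wpM2r//.
have := @geometric_half_le2 R k.
by rewrite /series/= /geometric/=; under eq_bigr do rewrite mul1r.
Qed.

(** * Rapidly Cauchy sequences in L^p *)

Section fast_cauchy.
Context d (T : measurableType d) (R : realType).
Variable mu : {measure set T -> \bar R}.

(** The rate is the product of 2^(-pk) and 2^(-k). Weighted by 2^(pk), the p-th powers of the
    increments still have integrals at most 2^(-k), so their sum [H] is integrable and a.e. finite.
    Where [H] is finite, the k-th increment is at most H^(1/p) 2^(-k), and |g 0| + 2 H^(1/p) is a
    majorant. The last clause holds at every point because [Lp_on] asks for vanishing everywhere
    outside the domain. *)
Lemma fast_cauchy_Lp_dominated_cvg (p : R) (g : nat -> T -> R) : 1 <= p ->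
  (forall k, g k \in Lfun mu p%:E) ->
  (forall k, \int[mu]_x (`|g k.+1 x - g k x| `^ p) <= ((2 `^ p * 2)^-1) ^+ k) ->
  exists2 r, Lp_dominated_cvg mu p g r &
    forall x, (forall k, g k x = 0) -> r x = 0.
Proof.
move=> p1 Lg gk; have p0 : 0 < p by lra.
have P0 : 0 < 2 `^ p :> R by rewrite powR_gt0.
pose w k x := (2 `^ p) ^+ k * `|g k.+1 x - g k x| `^ p.
have w0 k x : 0 <= w k x by rewrite mulr_ge0 ?exprn_ge0 ?powR_ge0 ?(ltW P0).
have Ld k : (fun x => g k.+1 x - g k x) \in Lfun mu p%:E by exact: LfunB.
have mw k : measurable_fun setT (EFin \o w k).
  apply/measurable_EFinP; apply: measurable_funM => //.
  by apply: measurable_powR_norm; exact: Lfun_measurable (Ld k).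
(* [H] dominates all weighted increments at once, so that no Minkowski
   inequality for series is needed. *)
pose H x := (\sum_(0 <= k <oo) (w k x)%:E)%E.
have H0 x : (0 <= H x)%E by apply: nneseries_ge0 => k _ _; rewrite lee_fin.
have mH : measurable_fun setT H.
  by apply: ge0_emeasurable_sum => [k x _ _|k _]; [rewrite lee_fin|exact: mw].
have Hfin : (\int[mu]_x H x < +oo)%E.
  rewrite /H integral_nneseries//; last by move=> k x _; rewrite lee_fin.
  apply: (@le_lt_trans _ _ 2%:E); last by rewrite ltry.
  apply: lime_le.
    apply: is_cvg_nneseries => k _ _; apply: integral_ge0 => x _.
    by rewrite lee_fin.
  apply: nearW => n.
  apply: (@le_trans _ _ (series (geometric 1 (2^-1 : R)) n)%:E); last first.
    by rewrite lee_fin geometric_half_le2.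
  rewrite /series/= -sumEFin; apply: lee_sum => k _.
  have iw : mu.-integrable setT (EFin \o (fun x => `|g k.+1 x - g k x| `^ p)).
    exact: Lfun_integrable p1 (Ld k).
  rewrite /w; under eq_integral do rewrite EFinM.
  rewrite integralZl//.
  rewrite -[X in (_ * X)%E]fineK; last exact: integrable_fin_num.
  rewrite -EFinM lee_fin /geometric/= mul1r.
  have := ler_wpM2l (exprn_ge0 k (ltW P0)) (gk k).
  rewrite /Rintegral => /le_trans; apply.
  by rewrite -exprMn invfM mulrA divff ?gt_eqF// mul1r.
have iH : mu.-integrable setT H.
  apply/integrableP; split => //.
  by under eq_integral do rewrite gee0_abs//.
have aeH : {ae mu, forall x, H x \is a fin_num}.
  by apply: filterS (integrable_ae measurableT iH) => x; exact.
pose c x := fine (H x) `^ p^-1.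
have incr x k : H x \is a fin_num -> `|g k.+1 x - g k x| <= c x * 2^-1 ^+ k.
  move=> Hx; have wH : w k x <= fine (H x).
    rewrite -lee_fin fineK//.
    apply: le_trans (nneseries_lim_ge (m := 0) k.+1 _); last first.
      by move=> i _ _; rewrite lee_fin.
    rewrite big_nat_recr//=; apply: leeDr.
    by apply: sume_ge0 => i _; rewrite lee_fin.
  have -> : `|g k.+1 x - g k x| = (`|g k.+1 x - g k x| `^ p) `^ p^-1.
    by rewrite -powRrM divff ?gt_eqF// powRr1.
  have -> : (2^-1 : R) ^+ k = (((2 `^ p) ^+ k)^-1) `^ p^-1.
    rewrite -!powR_mulrn ?powR_ge0// -[in RHS]powRrM -powRN -powRrM.
    rewrite -powR_inv1// -powRrM; congr (_ `^ _); field; rewrite gt_eqF//.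
  rewrite /c -powRM ?fine_ge0// ?invr_ge0 ?exprn_ge0 ?(ltW P0)//.
  apply: ge0_ler_powR; rewrite ?nnegrE ?invr_ge0 ?(ltW p0) ?powR_ge0//.
    by rewrite mulr_ge0 ?fine_ge0// invr_ge0 exprn_ge0// ltW.
  by rewrite ler_pdivlMr ?exprn_gt0// mulrC.
(* Cut off to this set, the sequence converges at every point, so [r] is measurable as a pointwise
   limit and the majorant holds everywhere. *)
pose A := [set x | H x \is a fin_num].
have mA : measurable A by rewrite -[A]setTI; exact: emeasurable_fin_num.
pose gA k : T -> R := g k \_ A.
pose r x := limn (gA ^~ x).
have gA_cvg x : gA ^~ x @ \oo --> r x.
  rewrite /r; have [xA|xA] := boolP (x \in A).
    have E : gA ^~ x = g ^~ x by apply/funext => k; rewrite /gA patchE xA.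
    have xA' : H x \is a fin_num by move: xA; rewrite inE.
    rewrite E.
    by have [] := geometric_bounded_increments (fun k => incr x k xA').
  have -> : gA ^~ x = fun=> 0.
    by apply/funext => k; rewrite /gA patchE (negbTE xA).
  exact: is_cvg_cst.
have mgA k : measurable_fun setT (gA k).
  apply/(measurable_restrictT (g k) mA).
  by apply: measurable_funS (Lfun_measurable (Lg k)).
have mr : measurable_fun setT r.
  by apply: measurable_fun_cvg mgA _ => x _; exact: gA_cvg.
pose h x := `|g 0%N x| + 2 * c x.
have c0 x : 0 <= c x by exact: powR_ge0.
have h0 x : 0 <= h x by rewrite addr_ge0// mulr_ge0.
have Lh : h \in Lfun mu p%:E.
  apply: LfunD => //.
    apply: le_Lfun (Lg 0%N) _ => //.
      by apply: measurableT_comp => //; exact: Lfun_measurable (Lg 0%N).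
    by move=> x; rewrite normr_id.
  apply: LfunZ => //; apply: integrable_Lfun => //.
    apply: measurableT_comp (measurable_powR _) _.
    by apply: measurableT_comp mH => //.
  apply: le_integrable iH => //.
    apply/measurable_EFinP; apply: measurable_powR_norm.
    apply: measurableT_comp (measurable_powR _) _.
    by apply: measurableT_comp mH => //.
  move=> x _; rewrite /= ger0_norm ?powR_ge0// ger0_norm// -powRrM mulVf ?gt_eqF//.
  rewrite powRr1 ?fine_ge0// gee0_abs//.
  by have := H0 x; case: (H x) => //= *; rewrite leey.
have gAh k x : `|gA k x| <= h x.
  rewrite /gA patchE; have [xA|xA] := boolP (x \in A); last by rewrite normr0.
  have xA' : H x \is a fin_num by move: xA; rewrite inE.
  by have [_ +] := geometric_bounded_increments (fun k => incr x k xA'); exact.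
exists r; last first.
  move=> x gx0; apply: cvg_lim => //.
  rewrite (_ : gA ^~ x = fun=> 0); first exact: cvg_cst.
  by apply/funext => k; rewrite /gA patchE gx0 if_same.
split => //.
  apply: le_Lfun Lh _ => // x; rewrite (ger0_norm (h0 x)).
  have cn : `|gA n x| @[n --> \oo] --> `|r x| by exact: cvg_norm.
  rewrite -(cvg_lim _ cn)//; apply: limr_le.
    by apply/cvg_ex; eexists; exact: cn.
  exact: nearW.
exists h => //; apply: filterS aeH => x Hx.
have E k : gA k x = g k x by rewrite /gA patchE mem_set.
split; first by move=> k; rewrite -E.
by have := gA_cvg x; under eq_fun do rewrite E.
Qed.

End fast_cauchy.

Section Lp_dominated_limits.
Context d (T : measurableType d) (R : realType).
Variable mu : {measure set T -> \bar R}.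

Lemma Lp_dominated_cvg_pairing (p q : R) g r s : 1 < p -> p^-1 + q^-1 = 1 ->
  Lp_dominated_cvg mu p g r -> s \in Lfun mu q%:E ->
  \int[mu]_x (g k x * s x) @[k --> \oo] --> \int[mu]_x (r x * s x).
Proof.
move=> p1 pq [Lg Lr [h Lh hP]] Ls.
have ms : measurable_fun setT s := Lfun_measurable Ls.
apply: (@dominated_Rintegral _ _ _ _ _ _ (fun x => `|h x| * `|s x|)).
- by move=> k; apply: measurable_funM => //; exact: Lfun_measurable (Lg k).
- by apply: measurable_funM => //; exact: Lfun_measurable Lr.
- by apply: filterS hP => x [_ gr]; apply: cvgMl.
- have := Lfun_mul_integrable p1 pq Lh Ls.
  move=> /integrable_norm; congr (_.-integrable _ _).
  by apply/funext => x; rewrite /= normrM.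
- apply: filterS hP => x [gh _] k; rewrite normrM ler_wpM2r//.
  by apply: le_trans (gh k) _; exact: ler_norm.
Qed.

Lemma Lp_dominated_cvg_norm (p : R) g r : 1 < p ->
  Lp_dominated_cvg mu p g r ->
  \int[mu]_x (`|g k x| `^ p) @[k --> \oo] --> \int[mu]_x (`|r x| `^ p).
Proof.
move=> p1 [Lg Lr [h Lh hP]]; have p0 : 0 < p by lra.
apply: (@dominated_Rintegral _ _ _ _ _ _ (fun x => `|h x| `^ p)).
- by move=> k; apply: measurable_powR_norm; exact: Lfun_measurable (Lg k).
- by apply: measurable_powR_norm; exact: Lfun_measurable Lr.
- apply: filterS hP => x [_ gr].
  exact: (continuous_cvg _ (@continuous_powR_norm _ _ p0 _) gr).
- exact: Lfun_integrable (ltW p1) Lh.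
- apply: filterS hP => x [gh _] k; rewrite ger0_norm ?powR_ge0//.
  apply: ge0_ler_powR; rewrite ?nnegrE ?(ltW p0)//.
  by apply: le_trans (gh k) _; exact: ler_norm.
Qed.

End Lp_dominated_limits.

(** * The weighted flux [kappa x * spow (p - 1) (f x)] *)

Section weighted_spow.
Context d (T : measurableType d) (R : realType).
Variable mu : {measure set T -> \bar R}.
Context (p klow kup : R) (kappa : T -> R).
Hypothesis p1 : 1 < p.
Hypothesis mkappa : measurable_fun setT kappa.
Hypothesis klow0 : 0 < klow.
Hypothesis kappa_bnd : forall x, klow <= kappa x <= kup.

Lemma weight_gt0 x : 0 < kappa x.
Proof. by have /andP[+ _] := kappa_bnd x; exact: lt_le_trans. Qed.

Lemma weight_le x : kappa x <= kup.
Proof. by have /andP[] := kappa_bnd x. Qed.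

Lemma integrable_weighted_powR f : f \in Lfun mu p%:E ->
  mu.-integrable setT (EFin \o (fun x => kappa x * `|f x| `^ p)).
Proof.
move=> Lf; have iP := Lfun_integrable (ltW p1) Lf.
have mf := Lfun_measurable Lf.
apply: (@le_integrable _ _ _ _ _ _ _
  (fun x => kup%:E * (`|f x| `^ p)%:E)%E) => //.
- apply/measurable_EFinP; apply: measurable_funM => //.
  exact: measurable_powR_norm.
- move=> x _; rewrite lee_fin !normrM !(ger0_norm (powR_ge0 _ _)).
  rewrite ler_wpM2r ?powR_ge0//.
  by rewrite ger0_norm ?(ltW (weight_gt0 x))// (le_trans (weight_le x))// ler_norm.
- exact: integrableZl.
Qed.

Lemma measurable_spow : measurable_fun setT (spow (p - 1) : R -> R).
Proof.
by apply: continuous_measurable_fun; apply: continuous_spow; rewrite subr_gt0.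
Qed.

(** Since (p - 1) + 1 = p, a common bound on both arguments turns the product into a p-th power.
    This gives integrability, and later the majorant for the limit in the Euler-Lagrange
    equation. *)
Lemma weighted_spow_le x a b c : `|a| <= c -> `|b| <= c ->
  `|kappa x * spow (p - 1) a * b| <= kup * `|c| `^ p.
Proof.
move=> ac bc; have c0 : 0 <= c by exact: le_trans bc.
have p10 : 0 < p - 1 by rewrite subr_gt0.
have p0 : 0 < p := lt_trans ltr01 p1.
rewrite -mulrA normrM ger0_norm ?(ltW (weight_gt0 x))//.
apply: ler_pM => //; [exact: ltW (weight_gt0 x)|exact: weight_le|].
rewrite normrM norm_spow// -(mulr_powRB1 (normr_ge0 c) p0) mulrC.
rewrite (ger0_norm c0); apply: ler_pM; rewrite ?powR_ge0//.
by apply: ge0_ler_powR; rewrite ?nnegrE// ltW.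
Qed.

Lemma integrable_weighted_spow f g :
  f \in Lfun mu p%:E -> g \in Lfun mu p%:E ->
  mu.-integrable setT (EFin \o (fun x => kappa x * spow (p - 1) (f x) * g x)).
Proof.
move=> Lf Lg.
have [mf mg] := (Lfun_measurable Lf, Lfun_measurable Lg).
have p1' := ltW p1.
have Lfg : (fun x => `|f x| + `|g x|) \in Lfun mu p%:E.
  by apply: LfunD => //; [apply: le_Lfun Lf _ => //|apply: le_Lfun Lg _ => //];
    try (by apply: measurableT_comp); move=> x; rewrite normr_id.
apply: (@le_integrable _ _ _ _ _ _ _
  (fun x => kup%:E * (`|(`|f x| + `|g x|)| `^ p)%:E)%E) => //.
- apply/measurable_EFinP; apply: measurable_funM => //; apply: measurable_funM => //.
  exact: measurableT_comp measurable_spow _.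
- move=> x _; rewrite lee_fin.
  apply: (le_trans (@weighted_spow_le x _ _ (`|f x| + `|g x|) _ _));
    rewrite ?lerDl ?lerDr//.
  exact: ler_norm.
- by apply: integrableZl => //; exact: Lfun_integrable Lfg.
Qed.

(** The identity (p - 1) q = p turns the q-th power of the flux into the p-th power of [f]. *)
Lemma Lfun_weighted_spow q f : p^-1 + q^-1 = 1 -> f \in Lfun mu p%:E ->
  (fun x => kappa x * spow (p - 1) (f x)) \in Lfun mu q%:E.
Proof.
move=> pq Lf; have q1 := conjugate_gt1 p1 pq.
have mf := Lfun_measurable Lf.
have p0 : 0 < p := lt_trans ltr01 p1; have q0 : 0 < q := lt_trans ltr01 q1.
have p10 : 0 < p - 1 by rewrite subr_gt0.
have m1 : measurable_fun setT (fun x => kappa x * spow (p - 1) (f x)).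
  apply: measurable_funM => //; exact: measurableT_comp measurable_spow _.
apply: (integrable_Lfun (ltW q1) m1).
apply: (@le_integrable _ _ _ _ _ _ _
  (fun x => (kup `^ q)%:E * (`|f x| `^ p)%:E)%E) => //.
- by apply/measurable_EFinP; exact: measurable_powR_norm.
- move=> x _; rewrite lee_fin (ger0_norm (powR_ge0 _ _)).
  rewrite [`|kappa x * _|]normrM norm_spow//.
  rewrite (ger0_norm (ltW (weight_gt0 x))).
  rewrite powRM ?powR_ge0 ?(ltW (weight_gt0 x))// -powRrM.
  rewrite (conjugate_subM p1 pq).
  rewrite !normrM !(ger0_norm (powR_ge0 _ _)) ler_wpM2r ?powR_ge0//.
  apply: ge0_ler_powR; rewrite ?nnegrE ?(ltW q0) ?(ltW (weight_gt0 x))//.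
    exact: le_trans (ltW (weight_gt0 x)) (weight_le x).
  exact: weight_le.
- by apply: integrableZl => //; exact: Lfun_integrable (ltW p1) Lf.
Qed.

End weighted_spow.

(** * The variational problem *)

(** Tolerances for the minimizing sequence. Being nonincreasing, they put two consecutive terms
    below the same level [e k], so the closeness estimate applies to them; the bound 1/(k+1) sends
    them to 0. *)
Lemma fast_levels (R : realType) (e : nat -> R) : (forall k, 0 < e k) ->
  exists a : nat -> R, [/\ forall k, 0 < a k, forall k, a k.+1 <= a k,
    forall k, a k <= e k & forall k, a k <= k.+1%:R^-1].
Proof.
move=> e0.
pose a := fix a k := match k with
  | 0 => Num.min 1 (e 0%N)
  | k'.+1 => Num.min (a k') (Num.min (k'.+2%:R^-1) (e k'.+1)) end.
exists a; split.
- elim=> [|k IH] /=; rewrite ?lt_min ?ltr01 ?IH ?e0//.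
  by rewrite invr_gt0 ltr0n.
- by move=> k; rewrite /= ge_min lexx.
- by case=> [|k] /=; rewrite !ge_min lexx !orbT.
- by case=> [|k] /=; rewrite !ge_min ?invr1 lexx ?orbT.
Qed.

Section variational.
Context d (T : measurableType d) (R : realType).
Variable mu : {measure set T -> \bar R}.
Context (p q klow kup B : R) (kappa : T -> R).
Hypothesis p1 : 1 < p.
Hypothesis pq : p^-1 + q^-1 = 1.
Hypothesis mkappa : measurable_fun setT kappa.
Hypothesis klow0 : 0 < klow.
Hypothesis kappa_bnd : forall x, klow <= kappa x <= kup.

Hypothesis klow_kup : klow <= kup.

(* [G] is the graph of a linear functional on a subspace of [L^p]. *)
Variable G : set ((T -> R) * R).
Hypothesis G0 : G !=set0.
Hypothesis Glin : forall g l g' l' c, G (g, l) -> G (g', l') ->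
  G (fun x => g x + c * g' x, l + c * l').
Hypothesis GLp : forall g l, G (g, l) -> g \in Lfun mu p%:E.
Hypothesis Gbnd : forall g l, G (g, l) ->
  `|l| <= B * (\int[mu]_x (`|g x| `^ p)) `^ p^-1.

Let wE (g : T -> R) := \int[mu]_x (kappa x * `|g x| `^ p).

(** The minus sign fits l = - int f2 u, for which this is 1/p int kappa |G u|^p + int f2 u. *)
Let J (z : (T -> R) * R) := wE z.1 / p - z.2.

Let weighted_ge g : g \in Lfun mu p%:E ->
  klow * \int[mu]_x (`|g x| `^ p) <= wE g.
Proof.
move=> Lg; have ig := Lfun_integrable (ltW p1) Lg.
rewrite -RintegralZl//; apply: le_Rintegral => //.
- by have := integrableZl measurableT klow ig; apply: eq_integrable.
- exact: integrable_weighted_powR p1 mkappa klow0 kappa_bnd _ Lg.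
- by move=> x _; rewrite ler_wpM2r ?powR_ge0//; have /andP[] := kappa_bnd x.
Qed.

Let weighted_le g : g \in Lfun mu p%:E ->
  wE g <= kup * \int[mu]_x (`|g x| `^ p).
Proof.
move=> Lg; have ig := Lfun_integrable (ltW p1) Lg.
rewrite -RintegralZl//; apply: le_Rintegral => //.
- exact: integrable_weighted_powR p1 mkappa klow0 kappa_bnd _ Lg.
- by have := integrableZl measurableT kup ig; apply: eq_integrable.
- by move=> x _; rewrite ler_wpM2r ?powR_ge0//; have /andP[] := kappa_bnd x.
Qed.

Let Ip_ge0 (g : T -> R) : 0 <= \int[mu]_x (`|g x| `^ p).
Proof. by apply: Rintegral_ge0 => x _; exact: powR_ge0. Qed.

(** Young with weight [klow / 2] lets half of the energy absorb the linear term; the conjugate term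
    of Young is the constant [M]. *)
Let coercive : exists M, forall z, G z ->
  klow / 2 / p * \int[mu]_x (`|z.1 x| `^ p) - M <= J z.
Proof.
move: (p1) (klow0) => p1' k0.
exists ((klow / 2) `^ (1 - q) * `|B| `^ q / q) => -[g l] Gz.
have Lg := GLp Gz; have := weighted_ge Lg; have := Gbnd Gz.
set I := \int[mu]_x _; have I0 : 0 <= I by exact: Ip_ge0.
have k20 : 0 < klow / 2 by lra.
have p0 : 0 < p by lra.
have ip0 : 0 < p^-1 by rewrite invr_gt0.
have := weighted_young (I `^ p^-1) B p1 pq k20.
rewrite (ger0_norm (powR_ge0 _ _)) -powRrM mulVf ?gt_eqF// powRr1//.
move=> H1 H2 H3; rewrite /J/=.
have := ler_norm l.
have := ler_wpM2r (ltW ip0) H3.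
rewrite (mulrC B) in H2. 
lra.
Qed.

Let Gadd g l g' l' s t : G (g, l) -> G (g', l') ->
  G (fun x => s * g x + t * g' x, s * l + t * l').
Proof.
move=> Gg Gg'; have := Glin t (Glin (s - 1) Gg Gg) Gg'; congr (G (_, _)).
  by apply/funext => x; ring.
by ring.
Qed.

Let iw := integrable_weighted_powR (mu := mu) p1 mkappa klow0 kappa_bnd.

Let m := inf (J @` G).

Let has_infJ : has_inf (J @` G).
Proof.
split; first by have [z Gz] := G0; exists (J z); exists z.
have [M HM] := coercive; exists (- M) => _ [z Gz <-].
apply: le_trans (HM _ Gz); rewrite lerDr.
by rewrite mulr_ge0 ?Ip_ge0// !divr_ge0// ltW// (lt_trans _ p1).
Qed.

Let m_le z : G z -> m <= J z.
Proof. by move=> Gz; apply: ge_inf; [case: has_infJ|exists z]. Qed.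

(** At the midpoint the linear parts cancel, so the convexity gap of the energy, divided by p,
    equals (J u + J v)/2 - J(midpoint), which is below [e] because J(midpoint) >= m. The integrated
    uniform convexity inequality then controls the distance. *)
Let near_minimizers_close (eta : R) : 0 < eta -> exists2 e, 0 < e &
  forall u v, G u -> G v -> J u < m + e -> J v < m + e ->
    \int[mu]_x (`|v.1 x - u.1 x| `^ p) <= eta.
Proof.
have scale (e1 K k y1 y2 y3 y4 : R) : 0 <= k ->
    y1 <= e1 * (y2 + y3) + K * ((y2 + y3) / 2 - y4) ->
    k * y1 <= e1 * (k * y2 + k * y3) + K * (2^-1 * (k * y2 + k * y3) - k * y4).
  by move=> k0 /(ler_wpM2l k0); lra.
move=> eta0; have p0 : 0 < p := lt_trans ltr01 p1.
have ip0 : 0 < p^-1 by rewrite invr_gt0.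
have [M HM] := coercive.
pose c := klow / 2 / p; have c0 : 0 < c by rewrite !divr_gt0.
pose W := `|kup * ((m + 1 + M) / c)|.
have Wle z : G z -> J z < m + 1 -> wE z.1 <= W.
  case: z => g l Gz Jz; apply: le_trans (weighted_le (GLp Gz)) _.
  apply: le_trans _ (ler_norm _); rewrite ler_wpM2l//.
    exact: le_trans (ltW klow0) klow_kup.
  rewrite ler_pdivlMr// mulrC; have := HM _ Gz; rewrite -/c/=; lra.
(* The budget [klow * eta] is split into halves, one for the [e1] term and one for the [K] term;
   [W + 1] keeps the divisor positive. *)
pose e1 := klow * eta / (4 * (W + 1)).
have W0 : 0 <= W by exact: normr_ge0.
have e10 : 0 < e1 by rewrite divr_gt0 ?mulr_gt0// ltr_wpDl.
have [K K0 HK] := uniform_convexity_powR p1 e10.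
(* The entry 1 makes the energy bound [W] available; the other makes K p e at most half of
   [klow * eta]. *)
exists (Num.min 1 (klow * eta / (2 * K * p))).
  by rewrite lt_min ltr01 divr_gt0 ?mulr_gt0.
move=> [g l] [g' l'] Gg Gg'.
rewrite -!ltrBlDl !lt_min => /andP[Ju1 Jue] /andP[Jv1 Jve] /=.
have Wg : wE g <= W by apply: (Wle _ Gg); lra.
have Wg' : wE g' <= W by apply: (Wle _ Gg'); lra.
have [Lg Lg'] := (GLp Gg, GLp Gg').
have Gm := Gadd 2^-1 2^-1 Gg Gg'.
have Lm := GLp Gm; have Lb := LfunB (ltW p1) Lg' Lg.
apply: (@le_trans _ _ (klow^-1 * wE (fun x => g' x - g x))).
  by rewrite ler_pdivlMl//; exact: weighted_ge.
rewrite ler_pdivrMl//.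
have : wE (fun x => g' x - g x) <= e1 * (wE g' + wE g) +
   K * ((wE g' + wE g) / 2 - wE (fun x => 2^-1 * g x + 2^-1 * g' x)).
  pose S x := kappa x * `|g' x| `^ p + kappa x * `|g x| `^ p.
  pose D x := 2^-1 * S x - kappa x * `|2^-1 * g x + 2^-1 * g' x| `^ p.
  have i1 := iw Lg'; have i2 := iw Lg; have i3 := iw Lm; have i4 := iw Lb.
  have iS : mu.-integrable setT (EFin \o S) := integrableD measurableT i1 i2.
  have iZ (c' : R) f (i : mu.-integrable setT (EFin \o f)) :
    mu.-integrable setT (EFin \o (fun x => c' * f x)) :=
    integrableZl measurableT c' i.
  have iD : mu.-integrable setT (EFin \o D) :=
    integrableB measurableT (iZ _ _ iS) i3.
  have -> : wE g' + wE g = \int[mu]_x S x by rewrite RintegralD.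
  have -> : (\int[mu]_x S x) / 2 -
      wE (fun x => 2^-1 * g x + 2^-1 * g' x) = \int[mu]_x D x.
    by rewrite mulrC -RintegralZl// -RintegralB//; exact: iZ.
  rewrite /wE -!RintegralZl// -RintegralD//; [|exact: iZ..].
  apply: le_Rintegral => //.
    exact (integrableD measurableT (iZ e1 _ iS) (iZ K _ iD)).
  move=> x _; have := HK (g' x) (g x); rewrite /D /S.
  have -> : (g' x + g x) / 2 = 2^-1 * g x + 2^-1 * g' x by field.
  exact: scale (ltW (weight_gt0 klow0 kappa_bnd x)).
have := m_le Gm; rewrite /J/= in Ju1 Jue Jv1 Jve *.
move: (wE (fun x => g' x - g x)).
move: (wE (fun x => 2^-1 * g x + 2^-1 * g' x)) => Em Ed.

move: (wE g) (wE g') Wg Wg' Ju1 Jue Jv1 Jve.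
move=> Eg Eg' Wg Wg' Ju1 Jue Jv1 Jve H1 H2.
apply: (le_trans H2).
have H3 : K * ((Eg' + Eg) / 2 - Em) <= klow * eta / 2.
  rewrite -ler_pdivlMl//.
  have -> : K^-1 * (klow * eta / 2) = p * (klow * eta / (2 * K * p)).
    by field; rewrite !gt_eqF.
  set e := klow * eta / _ in Jue Jve *.
  have -> : (Eg' + Eg) / 2 - Em = p * ((Eg' / p + Eg / p) / 2 - Em / p).
    by field; rewrite gt_eqF.
  by rewrite ler_wpM2l ?(ltW p0)//; lra.
have H4 : e1 * (Eg' + Eg) <= klow * eta / 2.
  apply: (@le_trans _ _ (e1 * (2 * (W + 1)))).
    by rewrite ler_wpM2l ?(ltW e10)//; lra.
  rewrite le_eqVlt; apply/orP; left; apply/eqP.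
  by rewrite /e1; field; rewrite gt_eqF// ltr_wpDl.
lra.
Qed.

Let minimizing_sequence :
  exists (a : nat -> R) (u : nat -> (T -> R) * R) (r : T -> R),
  [/\ forall k, 0 < a k <= k.+1%:R^-1,
      forall k, G (u k) /\ J (u k) < m + a k,
      Lp_dominated_cvg mu p (fun k => (u k).1) r &
      forall x, (forall k, (u k).1 x = 0) -> r x = 0].
Proof.
(* Exactly the rate that [fast_cauchy_Lp_dominated_cvg] asks for. *)
pose eta k : R := ((2 `^ p * 2)^-1) ^+ k.
have eta0 k : 0 < eta k by rewrite exprn_gt0// invr_gt0 mulr_gt0// powR_gt0.
have [e eP] : {e : nat -> R & forall k, 0 < e k /\
  forall u v, G u -> G v -> J u < m + e k -> J v < m + e k ->
    \int[mu]_x (`|v.1 x - u.1 x| `^ p) <= eta k}.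
  apply: (@choice _ _ (fun k ek => 0 < ek /\ forall u v, G u -> G v ->
    J u < m + ek -> J v < m + ek ->
    \int[mu]_x (`|v.1 x - u.1 x| `^ p) <= eta k)) => k.
  by have [ek ek0 ekP] := near_minimizers_close (eta0 k); exists ek.
have [a [a0 adec ae ak]] := fast_levels (fun k => (eP k).1).
have [u uP] : {u : nat -> (T -> R) * R &
    forall k, G (u k) /\ J (u k) < m + a k}.
  apply: (@choice _ _ (fun k uk => G uk /\ J uk < m + a k)) => k.
  by have [_ [z Gz <-] Jz] := inf_adherent (a0 k) has_infJ; exists z.
have Lu k : (u k).1 \in Lfun mu p%:E.
  by have [+ _] := uP k; case: (u k) => g l; exact: GLp.
have [|r ur r0] := @fast_cauchy_Lp_dominated_cvg _ _ _ mu p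
  (fun k => (u k).1) (ltW p1) Lu.
  move=> k; have [Gk Jk] := uP k; have [Gk1 Jk1] := uP k.+1.
  apply: (eP k).2 => //.
    by apply: lt_le_trans Jk _; rewrite lerD2l.
  by apply: lt_le_trans Jk1 _; rewrite lerD2l (le_trans (adec k)).
by exists a, u, r; split => // k; rewrite a0 ak.
Qed.

Theorem variational_solution : exists (u : nat -> (T -> R) * R) (r : T -> R),
  [/\ forall k, G (u k), Lp_dominated_cvg mu p (fun k => (u k).1) r,
      forall x, (forall k, (u k).1 x = 0) -> r x = 0 &
      forall g l, G (g, l) ->
        \int[mu]_x (kappa x * spow (p - 1) (r x) * g x) = l].
Proof.
have scale (k y1 y2 y3 t g : R) : 0 <= k -> y1 / p <= y2 / p + y3 * (t * g) ->
    p^-1 * (k * y1) <= p^-1 * (k * y2) + t * (k * y3 * g).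
  by move=> k0 /(ler_wpM2l k0); lra.
have descent (x y s a X l lv : R) : m <= y - (lv + s * l) -> x - lv < m + a ->
    y <= x + s * X -> s * l <= a + s * X by lra.
have [a [u [r [aP uP ur r0]]]] := minimizing_sequence.
exists u, r; split => //; first by move=> k; have [] := uP k.
have p0 : 0 < p := lt_trans ltr01 p1.
have p10 : 0 < p - 1 by rewrite subr_gt0.
have [Lu Lr [h Lh hP]] := ur.
have isp := integrable_weighted_spow (mu := mu) p1 mkappa klow0 kappa_bnd.
suff main g l : G (g, l) ->
    l <= \int[mu]_x (kappa x * spow (p - 1) (r x) * g x).
  move=> g l Gg; apply/eqP; rewrite eq_le main// andbT.
  (* The pair (-g, -l) also lies in [G], and for it the one-sided inequality is the reverse one. *)
  have := main _ _ (Gadd 0 (-1) Gg Gg).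
  under eq_Rintegral do rewrite mul0r add0r mulN1r mulrN -mulN1r.
  rewrite RintegralZl//; last exact: isp Lr (GLp Gg).
  by rewrite mul0r add0r !mulN1r lerN2.
move=> Gg; have Lg := GLp Gg.
(* Near-minimality up to [a k], tested at distance [t k], costs only [t k]. *)
pose t k := Num.sqrt (a k).
have a0 k : 0 < a k by have /andP[] := aP k.
have t0 k : 0 < t k by rewrite sqrtr_gt0.
have t1 k : t k <= 1.
  rewrite -sqrtr1 ler_wsqrtr//; have /andP[_ /le_trans] := aP k; apply.
  by rewrite invf_le1// ler1n.
have tcvg : t @ \oo --> (0 : R).
  rewrite -(sqrtr0 R); apply: (continuous_cvg _ (@sqrt_continuous R _)).
  apply: (squeeze_cvgr _ (cvg_cst 0) cvg_harmonic).
  by apply: nearW => k; have /andP[/ltW -> +] := aP k.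
pose X k := \int[mu]_x (kappa x * spow (p - 1) ((u k).1 x + t k * g x) * g x).
have Lt k : (fun x => (u k).1 x + t k * g x) \in Lfun mu p%:E.
  by apply: LfunD (ltW p1) _ _ => //; apply: LfunZ (ltW p1) _.
have step k : l <= t k + X k.
  have [Gk Jk] := uP k; case E: (u k) => [v lv].
  rewrite E in Gk Jk; have Lv := GLp Gk.
  have Gt := Glin (t k) Gk Gg; have Lt' := GLp Gt.
  have := m_le Gt; rewrite /J/= => mt; rewrite /J/= in Jk.
  have conv : wE (fun x => v x + t k * g x) / p <= wE v / p + t k * X k.
    have iZ (c' : R) f (i : mu.-integrable setT (EFin \o f)) :
      mu.-integrable setT (EFin \o (fun x => c' * f x)) :=
    integrableZl measurableT c' i.
    have i1 := iw Lt'; have i2 := iw Lv; have i3 := isp _ _ Lt' Lg.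
    have XE : X k =
        \int[mu]_x (kappa x * spow (p - 1) (v x + t k * g x) * g x).
      by rewrite /X E.
    rewrite XE [leLHS]mulrC [wE v / p]mulrC.
    have e1 := RintegralZl p^-1 measurableT i1.
    have e2 := RintegralZl p^-1 measurableT i2.
    have e3 := RintegralZl (t k) measurableT i3.
    have e23 := RintegralD measurableT (iZ p^-1 _ i2) (iZ (t k) _ i3).
    rewrite -[leLHS]e1 -[X in _ <= X + _]e2 -[X in _ <= _ + X]e3 -[leRHS]e23.
    apply: (le_Rintegral measurableT (iZ p^-1 _ i1)).
      exact (integrableD measurableT (iZ p^-1 _ i2) (iZ (t k) _ i3)).
    move=> x _; apply: scale (ltW (weight_gt0 klow0 kappa_bnd x)) _.
    exact: powR_norm_add_le.
  have tt : t k * t k = a k by rewrite -expr2 sqr_sqrtr// ltW.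
  rewrite -(ler_pM2l (t0 k)) mulrDr tt.
  exact: descent mt Jk conv.
have Xcvg : X @ \oo --> \int[mu]_x (kappa x * spow (p - 1) (r x) * g x).
  have Labs f : f \in Lfun mu p%:E -> (fun x => `|f x|) \in Lfun mu p%:E.
    move=> Lf; apply: (le_Lfun (ltW p1) _ Lf) => [|x]; last by rewrite normr_id.
    by apply: measurableT_comp => //; exact: Lfun_measurable Lf.
  have LH := LfunD (ltW p1) (Labs _ Lh) (Labs _ Lg).
  (* As [t k <= 1], the function |h| + |g| dominates both the displaced gradient and [g], uniformly
     in k. *)
  apply: (@dominated_Rintegral _ _ _ _ _ _
    (fun x => kup * `| `|h x| + `|g x| | `^ p)).
  - by move=> k; apply/measurable_EFinP; exact: measurable_int (isp _ _ (Lt k) Lg).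
  - by apply/measurable_EFinP; exact: measurable_int (isp _ _ Lr Lg).
  - apply: filterS hP => x [_ gr]; apply: cvgMl; apply: cvgMr.
    apply: (continuous_cvg _ (@continuous_spow _ _ p10 _)).
    rewrite -[X in _ --> X]addr0 -(mul0r (g x)); apply: cvgD => //.
    exact: cvgMl.
  - exact (integrableZl measurableT kup (Lfun_integrable (ltW p1) LH)).
  - apply: filterS hP => x [gh _] k.
    apply: weighted_spow_le p1 klow0 kappa_bnd _ _ _ _ _ _; last by rewrite lerDr.
    apply: le_trans (ler_normD _ _) _; apply: lerD.
      by apply: le_trans (gh k) _; exact: ler_norm.
    by rewrite normrM ler_piMl// ger0_norm// ltW.
have sumcvg : t k + X k @[k --> \oo] -->
    0 + \int[mu]_x (kappa x * spow (p - 1) (r x) * g x).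
  exact: cvgD.
rewrite -[X in _ <= X]add0r -(cvg_lim _ sumcvg)//.
apply: limr_ge; first by apply/cvg_ex; eexists; exact: sumcvg.
exact: nearW.
Qed.

End variational.

(** Divide by [y] and raise to the power q - 1, the inverse of p - 1. With y = |r|_p this is the a
    priori bound on [r]. *)
Lemma conjugate_powR_le (R : realType) (p q k b y : R) :
  1 < p -> p^-1 + q^-1 = 1 ->
  0 < k -> 0 <= b -> 0 <= y -> k * y `^ p <= b * y -> y <= (b / k) `^ (q - 1).
Proof.
move=> p1 pq k0 b0; have q1 := conjugate_gt1 p1 pq.
have p0 : 0 < p by lra.
have q0 : 0 < q by lra.
rewrite le_eqVlt => /predU1P[<- _|y0]; first exact: powR_ge0.
rewrite -(mulr_powRB1 (ltW y0) p0) mulrCA (mulrC b) ler_pM2l// => H.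
have pq1 : (p - 1) * (q - 1) = 1.
  by rewrite mulrBr (conjugate_subM p1 pq); ring.
have -> : y = (y `^ (p - 1)) `^ (q - 1) by rewrite -powRrM pq1 powRr1// ltW.
apply: ge0_ler_powR; rewrite ?nnegrE ?powR_ge0//; first by lra.
  by rewrite divr_ge0// ltW.
by rewrite ler_pdivlMr// mulrC.
Qed.

(** * The dual energy and its competitor *)

Section dual_energy.
Context d (T : measurableType d) (R : realType).
Variable mu : {measure set T -> \bar R}.
Context (p q klow kup : R) (kappa : T -> R).
Hypothesis p1 : 1 < p.
Hypothesis pq : p^-1 + q^-1 = 1.
Hypothesis mkappa : measurable_fun setT kappa.
Hypothesis klow0 : 0 < klow.
Hypothesis kappa_bnd : forall x, klow <= kappa x <= kup.

Lemma integrable_dual_energy s : s \in Lfun mu q%:E ->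
  mu.-integrable setT (EFin \o (fun x => kappa x `^ (1 - q) * `|s x| `^ q)).
Proof.
move=> Ls; have q1 := conjugate_gt1 p1 pq; have q0 := lt_trans ltr01 q1.
have ms := Lfun_measurable Ls.
apply: (@le_integrable _ _ _ _ _ _ _
  (fun x => (klow `^ (1 - q))%:E * (`|s x| `^ q)%:E)%E) => //.
- apply/measurable_EFinP; apply: measurable_funM; last exact: measurable_powR_norm.
  exact: measurableT_comp (measurable_powR _) _.
- move=> x _; rewrite lee_fin !normrM !(ger0_norm (powR_ge0 _ _)).
  rewrite ler_wpM2r ?powR_ge0// -(opprB q 1) !powRN.
  have k0 := weight_gt0 klow0 kappa_bnd x; have /andP[lk _] := kappa_bnd x.
  rewrite lef_pV2 ?posrE ?powR_gt0//.
  by apply: ge0_ler_powR; rewrite ?nnegrE ?subr_ge0 ?(ltW q1) ?(ltW k0) ?(ltW klow0).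
- exact (integrableZl measurableT _ (Lfun_integrable (ltW q1) Ls)).
Qed.

Hypothesis klow_kup : klow <= kup.
Variable B : R.
Hypothesis B0 : 0 <= B.
Variable G : set ((T -> R) * R).
Hypothesis G0 : G !=set0.
Hypothesis Glin : forall g l g' l' c, G (g, l) -> G (g', l') ->
  G (fun x => g x + c * g' x, l + c * l').
Hypothesis GLp : forall g l, G (g, l) -> g \in Lfun mu p%:E.
Hypothesis Gbnd : forall g l, G (g, l) ->
  `|l| <= B * (\int[mu]_x (`|g x| `^ p)) `^ p^-1.

(** The witness gives equality in the weighted Young inequality, so a single number [om] is at once
    int r sigma, the weighted p-energy of [r], and q times the dual energy of [sigma]. Young for [r]
    and [s] costs om/p, and the remaining om/q is the dual energy to be bounded. *)
Theorem dual_competitor : exists sigma : T -> R,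
  [/\ sigma \in Lfun mu q%:E,
      forall x, (forall g l, G (g, l) -> g x = 0) -> sigma x = 0,
      forall g l, G (g, l) -> \int[mu]_x (sigma x * g x) = l &
      forall s c, s \in Lfun mu q%:E -> 0 <= c ->
        (forall g l, G (g, l) -> `|\int[mu]_x (g x * (sigma x - s x))| <=
          c * (\int[mu]_x (`|g x| `^ p)) `^ p^-1) ->
        \int[mu]_x (kappa x `^ (1 - q) * `|sigma x| `^ q) / q <=
        \int[mu]_x (kappa x `^ (1 - q) * `|s x| `^ q) / q +
        c * (B / klow) `^ (q - 1)].
Proof.
have [u [r [Gu ur r0 EL]]] := variational_solution p1 pq mkappa klow0 kappa_bnd
  klow_kup G0 Glin GLp Gbnd.
have q1 := conjugate_gt1 p1 pq; have q0 := lt_trans ltr01 q1.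
have p0 : 0 < p := lt_trans ltr01 p1; have p10 : 0 < p - 1 by rewrite subr_gt0.
have [Lu Lr _] := ur.
have Ls := Lfun_weighted_spow p1 mkappa klow0 kappa_bnd pq Lr.
exists (fun x => kappa x * spow (p - 1) (r x)); set sigma := fun x => _ in Ls *.
have sigma0 x : r x = 0 -> sigma x = 0.
  by move=> rx; rewrite /sigma rx spow_ge0// normr0 powR0 ?mulr0// gt_eqF.
split => //.
- move=> x gx; apply/sigma0/r0 => k.
  by have := Gu k; case: (u k) => g l; exact: gx.
pose rho := \int[mu]_x (`|r x| `^ p).
have Ip0 (g : T -> R) : 0 <= \int[mu]_x (`|g x| `^ p).
  by apply: Rintegral_ge0 => x _; exact: powR_ge0.
have rho0 : 0 <= rho by exact: Ip0.
(* A bound known on [G] reaches [r] along the sequence. It serves twice: with [s] replaced by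
   [sigma] to bound |r|_p, and by [sigma - s] for the perturbation. *)
have lim_pairing s c : s \in Lfun mu q%:E ->
    (forall g l, G (g, l) -> `|\int[mu]_x (g x * s x)| <=
      c * (\int[mu]_x (`|g x| `^ p)) `^ p^-1) ->
    `|\int[mu]_x (r x * s x)| <= c * rho `^ p^-1.
  move=> Lss H.
  have c1 : `|\int[mu]_x ((u k).1 x * s x)| @[k --> \oo] -->
      `|\int[mu]_x (r x * s x)|.
    by apply: cvg_norm; exact: Lp_dominated_cvg_pairing p1 pq ur Lss.
  have c2 : c * (\int[mu]_x (`|(u k).1 x| `^ p)) `^ p^-1 @[k --> \oo] -->
      c * rho `^ p^-1.
    apply: cvgMr.
    have ip0 : 0 < p^-1 by rewrite invr_gt0.
    rewrite -(ger0_norm rho0).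
    have -> : (fun k => (\int[mu]_x (`|(u k).1 x| `^ p)) `^ p^-1) =
        (fun k => `| \int[mu]_x (`|(u k).1 x| `^ p) | `^ p^-1).
      by apply/funext => k; rewrite (ger0_norm (Ip0 _)).
    exact: (continuous_cvg _ (@continuous_powR_norm _ _ ip0 _)
      (Lp_dominated_cvg_norm p1 ur)).
  rewrite -(cvg_lim _ c1)// -(cvg_lim _ c2)//.
  apply: ler_lim; [by apply/cvg_ex; eexists; exact: c1|
                   by apply/cvg_ex; eexists; exact: c2|].
  by apply: nearW => k; have := Gu k; case: (u k) => g l; exact: H.
pose om := \int[mu]_x (kappa x * `|r x| `^ p).
have rs x : r x * sigma x = kappa x * `|r x| `^ p.
  by rewrite /sigma mulrCA (mulrC (r x)) spowM// subrK.
have omE : \int[mu]_x (r x * sigma x) = om by apply: eq_Rintegral => x _; exact: rs.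
have iom := integrable_weighted_powR p1 mkappa klow0 kappa_bnd Lr.
have rho_om : klow * rho <= om.
  rewrite -RintegralZl//; last exact: Lfun_integrable (ltW p1) Lr.
  apply: le_Rintegral => //.
    exact (integrableZl measurableT klow (Lfun_integrable (ltW p1) Lr)).
  by move=> x _; rewrite ler_wpM2r ?powR_ge0//; have /andP[] := kappa_bnd x.
have om_le : om <= B * rho `^ p^-1.
  rewrite -omE; apply: le_trans (ler_norm _) _; apply: lim_pairing => // g l Gg.
  under eq_Rintegral do rewrite mulrC.
  by rewrite (EL _ _ Gg); exact: Gbnd Gg.
have rho_le : rho `^ p^-1 <= (B / klow) `^ (q - 1).
  apply: (conjugate_powR_le p1 pq klow0 B0 (powR_ge0 _ _)).
  by rewrite -powRrM mulVf ?gt_eqF// powRr1// (le_trans rho_om).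
move=> s c Lss c0 H.
have Fsigma : \int[mu]_x (kappa x `^ (1 - q) * `|sigma x| `^ q) = om.
  apply: eq_Rintegral => x _; rewrite /sigma normrM norm_spow//.
  have k0 := weight_gt0 klow0 kappa_bnd x.
  rewrite gtr0_norm// powRM ?powR_ge0 ?(ltW k0)// mulrA -powRD; last first.
    by rewrite (gt_eqF k0) implybT.
  rewrite subrK powRr1 ?(ltW k0)// -powRrM; congr (_ * _ `^ _).
  exact: conjugate_subM.
have irs := Lfun_mul_integrable p1 pq Lr Lss.
have irsig := Lfun_mul_integrable p1 pq Lr Ls.
have Lds := LfunB (ltW q1) Ls Lss.
pose Fs := \int[mu]_x (kappa x `^ (1 - q) * `|s x| `^ q).
have young : \int[mu]_x (r x * s x) <= p^-1 * om + q^-1 * Fs.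
  have iF := integrable_dual_energy Lss.
  have iZ (c' : R) f (i : mu.-integrable setT (EFin \o f)) :
    mu.-integrable setT (EFin \o (fun x => c' * f x)) :=
    integrableZl measurableT c' i.
  have e1 := RintegralZl p^-1 measurableT iom.
  have e2 := RintegralZl q^-1 measurableT iF.
  have e12 := RintegralD measurableT (iZ p^-1 _ iom) (iZ q^-1 _ iF).
  rewrite -[X in _ <= X + _]e1 -[X in _ <= _ + X]e2 -[leRHS]e12.
  apply: (le_Rintegral measurableT irs).
    exact (integrableD measurableT (iZ p^-1 _ iom) (iZ q^-1 _ iF)).
  move=> y _; rewrite ![_^-1 * _]mulrC.
  exact: weighted_young p1 pq (weight_gt0 klow0 kappa_bnd y).
have diff : \int[mu]_x (r x * (sigma x - s x)) = om - \int[mu]_x (r x * s x).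
  rewrite -omE -[RHS](RintegralB measurableT irsig irs).
  by apply: eq_Rintegral => x _; rewrite mulrBr.
have := le_trans (ler_norm _) (lim_pairing _ c Lds H); rewrite diff Fsigma -/Fs.
have := ler_wpM2l c0 rho_le.
move: (om) (Fs) (\int[mu]_x (r x * s x)) (rho `^ p^-1) young => o F y z.
have -> : p^-1 = 1 - q^-1 by rewrite -pq addrK.
lra.
Qed.

End dual_energy.

(** * The nonlocal problem *)

(** The outer [C] multiplies |f2 - f1|_q in the perturbation term. Inside the power, [C * (t + 1)]
    bounds C |f2|_q when t = |f1|_q. *)
Definition stability_const (R : realType) (t q C klow : R) : R :=
  C * (C * (t + 1) / klow) `^ (q - 1).

Lemma stability_const_props (R : realType) (q C klow : R) :
  1 < q -> 0 < C -> 0 < klow ->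
  [/\ {within `[0, +oo[, continuous (fun t => stability_const t q C klow)},
      forall s t, 0 <= s -> s <= t ->
        stability_const s q C klow <= stability_const t q C klow &
      forall t, 0 <= t -> 0 < stability_const t q C klow].
Proof.
move=> q1 C0 k0; have q10 : 0 < q - 1 by lra.
have base t : 0 <= t -> 0 < C * (t + 1) / klow.
  by move=> t0; rewrite divr_gt0// mulr_gt0// ltr_wpDl.
(* The absolute value yields a function continuous on the whole line; on [0, +oo[ the base is
   positive and the two functions agree. *)
have cont : continuous (fun t : R => C * `|C * (t + 1) / klow| `^ (q - 1)).
  move=> t; have ct : {for t, continuous (fun t : R => C * (t + 1) / klow)}.
    by apply: cvgMl; apply: cvgMr; apply: cvgD; [exact: cvg_id|exact: cvg_cst].
  apply: cvgMr; exact: (continuous_comp ct (@continuous_powR_norm _ _ q10 _)).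
split.
- have E : {in (`[0, +oo[%classic : set R),
      (fun t => C * `|C * (t + 1) / klow| `^ (q - 1)) =1 (fun t => stability_const t q C klow)}.
    move=> t; rewrite inE/= in_itv/= andbT => t0.
    by rewrite gtr0_norm// base.
  apply: (subspace_eq_continuous E); exact: (continuous_subspaceT cont).
- move=> s t s0 st; rewrite ler_wpM2l ?(ltW C0)//.
  have t0 := le_trans s0 st.
  apply: ge0_ler_powR; rewrite ?nnegrE ?(ltW q10) ?(ltW (base _ _))//.
  by rewrite ler_wpM2r ?invr_ge0 ?(ltW k0)// ler_wpM2l ?(ltW C0)// lerD2r.
- by move=> t t0; rewrite mulr_gt0// powR_gt0// base.
Qed.

Section Lp_on_facts.
Context d (T : measurableType d) (R : realType).
Variables (mu : {measure set T -> \bar R}) (D : set T).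

(** Extension by zero moves integrals to the whole space, where the L^p tools are stated, without
    any measurability of [D]. *)
Lemma Rintegral_vanish (f : T -> R) : (forall x, ~ D x -> f x = 0) ->
  \int[mu]_(x in D) f x = \int[mu]_x f x.
Proof.
move=> f0; rewrite Rintegral_mkcond; apply: eq_Rintegral => x _.
by rewrite patchE; case: ifPn => // xD; rewrite f0//; move: xD; rewrite notin_setE.
Qed.

Lemma integral_vanish (f : T -> R) : (forall x, ~ D x -> f x = 0) ->
  (\int[mu]_(x in D) (f x)%:E = \int[mu]_x (f x)%:E)%E.
Proof.
move=> f0; rewrite integral_mkcond; apply: eq_integral => x _.
by rewrite patchE; case: ifPn => // xD; rewrite f0//; move: xD; rewrite notin_setE.
Qed.

Lemma Lp_on_linear (p : R) (f g : T -> R) c : 1 <= p ->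
  Lp_on mu D p%:E f -> Lp_on mu D p%:E g ->
  Lp_on mu D p%:E (fun x => f x + c * g x).
Proof.
move=> p1 [Lf f0] [Lg g0]; split; first by apply: LfunD => //; exact: LfunZ.
by move=> x Dx; rewrite f0// g0// mulr0 addr0.
Qed.

Lemma Lp_on0 (p : R) : 1 <= p -> Lp_on mu D p%:E (fun=> 0).
Proof. by move=> p1; split => //; have [+ _] := @Lfun_addr_closed _ T R mu p%:E p1. Qed.

End Lp_on_facts.

Section nonlocal_facts.
Context (R : realType) (n : nat) (Omega : set 'rV[R]_n) (p q delta : R).
Context (w : 'rV[R]_n -> R).
Local Notation V := 'rV[R]_n.
Local Notation leb := (lebesgue_rV R n).
Local Notation E2 := (enlarge2 Omega delta).
Local Notation nl := (nlgrad Omega delta w).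

Lemma nlgrad_linear u v c :
  nl (fun x => u x + c * v x) = (fun z => nl u z + c * nl v z).
Proof.
apply/funext => z; rewrite /nlgrad !patchE; case: ifPn => _; first by ring.
by rewrite mulr0 addr0.
Qed.

Lemma U0_linear u v c : 1 <= p -> U0 Omega p delta w u -> U0 Omega p delta w v ->
  U0 Omega p delta w (fun x => u x + c * v x).
Proof.
move=> p1 [Lu Lnu] [Lv Lnv]; split; first exact: Lp_on_linear.
by rewrite nlgrad_linear; exact: Lp_on_linear.
Qed.

Lemma U0_0 : 1 <= p -> U0 Omega p delta w (fun=> 0).
Proof.
move=> p1; split; first exact: Lp_on0.
rewrite (_ : nl _ = fun=> 0); first exact: Lp_on0.
by apply/funext => z; rewrite /nlgrad patchE subrr mul0r if_same.
Qed.

End nonlocal_facts.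

Section clamp.
Context (R : realType) (n : nat) (Omega : set 'rV[R]_n) (delta klow kup q : R).
Context (kappa : 'rV[R]_n * 'rV[R]_n -> R).
Local Notation E2 := (enlarge2 Omega delta).

(* The bounds on [kappa] only hold a.e. on [E2]; those on [clamp] hold
   everywhere, and every integrand below vanishes off [E2]. *)
Definition clamp z := Num.max klow (Num.min kup (kappa z)).

Hypothesis klow_kup : klow <= kup.

Lemma clamp_bnd z : klow <= clamp z <= kup.
Proof. by rewrite /clamp le_max lexx/= ge_max klow_kup ge_min lexx. Qed.

Lemma measurable_clamp : measurable_fun setT kappa -> measurable_fun setT clamp.
Proof. by move=> mk; apply: measurable_maxr => //; exact: measurable_minr. Qed.

(** On the enlarged domain clamping changes [kappa] only on a null set, and elsewhere [sigma]
    vanishes. The clamped integrand is integrable, so the extended-valued energy is a real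
    number. *)
Lemma energy_clamp sigma : 0 < klow -> 1 < q -> measurable_fun setT kappa ->
  {ae leb2, forall z, E2 z -> klow <= kappa z <= kup} ->
  Lp_on leb2 E2 q%:E sigma ->
  energy Omega q delta kappa sigma =
  (\int[leb2]_z (clamp z `^ (1 - q) * `|sigma z| `^ q) / q)%:E.
Proof.
move=> k0 q1 mk aek [Ls s0]; have q0 : 0 < q by lra.
have ms := Lfun_measurable Ls.
(* Only [q] is at hand here, so its conjugate exponent is rebuilt from it. *)
have p1 : 1 < (1 - q^-1)^-1.
  by rewrite invf_gt1 ?subr_gt0 ?invf_lt1// ltrBlDr ltrDl invr_gt0.
have pq : ((1 - q^-1)^-1)^-1 + q^-1 = 1 by rewrite invrK subrK.
have iF := integrable_dual_energy p1 pq (measurable_clamp mk) k0 clamp_bnd Ls.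
rewrite /energy integral_vanish; last first.
  by move=> z /s0 ->; rewrite normr0 powR0 ?mulr0// gt_eqF.
rewrite mulrC EFinM; congr (_ * _)%E.
rewrite /Rintegral fineK; last exact: integrable_fin_num.
apply: ae_eq_integral => //.
- apply/measurable_EFinP; apply: measurable_funM; last exact: measurable_powR_norm.
  exact: measurableT_comp (measurable_powR _) _.
- exact: measurable_int iF.
apply: filterS aek => z kz _; congr EFin.
have [zE|zE] := pselect (E2 z); last by rewrite s0// normr0 powR0 ?mulr0// gt_eqF.
have /andP[k1 k2] := kz zE.
by rewrite /clamp (min_r k2) (max_r k1).
Qed.

End clamp.

Theorem corollary2p8 (R : realType) :
  exists L : R -> R -> R -> R -> R,
  (forall q C klow : R, 1 < q -> 0 < C -> 0 < klow ->
     [/\ {within `[0, +oo[, continuous (fun t => L t q C klow)},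
         forall s t, 0 <= s -> s <= t -> L s q C klow <= L t q C klow &
         forall t, 0 <= t -> 0 < L t q C klow]) /\
  forall (n : nat) (p q : R) (Omega : set 'rV[R]_n),
  (2 <= n)%N -> 1 < p -> p^-1 + q^-1 = 1 -> lipschitz_domain Omega ->
  forall (e : 'rV[R]_n) (omega : R -> 'rV[R]_n -> R),
  enorm e = 1 ->
  (forall delta, 0 < delta -> is_kernel p e delta (omega delta)) ->
  forall deltabar C : R, 0 < deltabar -> 0 < C ->
  poincare Omega p omega deltabar C ->
  forall (klow kup : R) (A : R -> set ('rV[R]_n * 'rV[R]_n -> R)),
  0 < klow -> klow <= kup ->
  (forall delta, 0 < delta ->
     conductivities Omega klow kup delta (A delta)) ->
  forall delta : R, 0 < delta < deltabar ->
  forall (kappa : 'rV[R]_n * 'rV[R]_n -> R) (f1 f2 : 'rV[R]_n -> R)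
    (sigma1 sigma2 : 'rV[R]_n * 'rV[R]_n -> R),
  A delta kappa ->
  Lp_on (lebesgue_rV R n) Omega q%:E f1 ->
  Lp_on (lebesgue_rV R n) Omega q%:E f2 ->
  ('N[lebesgue_rV R n]_(q%:E)[EFin \o (f2 \- f1)%R] < 1)%E ->
  energy_minimizer Omega p q delta (omega delta) kappa f1 sigma1 ->
  energy_minimizer Omega p q delta (omega delta) kappa f2 sigma2 ->
  (energy Omega q delta kappa sigma2 <=
   energy Omega q delta kappa sigma1 +
   (L (fine 'N[lebesgue_rV R n]_(q%:E)[EFin \o f1]) q C klow)%:E *
   'N[lebesgue_rV R n]_(q%:E)[EFin \o (f2 \- f1)%R])%E.
Proof.
exists (@stability_const R); split; first exact: stability_const_props.
move=> n p q Omega _ p1 pq _ e omega _ _ deltabar C _ C0 Hpoin klow kup A k0 klk HA.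
move=> delta dd kappa f1 f2 s1 s2 Ak Lf1 Lf2 N1 [[Ls1 _ div1] _] [_ min2].
have q1 := conjugate_gt1 p1 pq.
have /andP[d0 _] := dd.
have [_ /(_ _ Ak) Lk _ _ /(_ _ Ak) aek] := HA _ d0.
set w := omega delta in div1 min2 *; set E2 := enlarge2 Omega delta.
have mk : measurable_fun setT kappa by have [Lk0 _] := Lk; exact: Lfun_measurable Lk0.
have {}aek : {ae leb2, forall z, E2 z -> klow <= kappa z <= kup}.
  by apply: filterS aek => z kz /kz[].
pose Nf (f : 'rV[R]_n -> R) := fine ('N[lebesgue_rV R n]_(q%:E)[EFin \o f])%E.
pose nl := nlgrad Omega delta w.
have nl0 u z : ~ E2 z -> nl u z = 0 by move=> zE; rewrite /nl /nlgrad patchE memNset.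
(* Hölder on [Omega], then Poincaré. With [f2] this is the boundedness of the functional; with
   [f2 - f1] it is the size of the perturbation. *)
have bound f u : Lp_on (lebesgue_rV R n) Omega q%:E f -> U0 Omega p delta w u ->
    `|\int[lebesgue_rV R n]_(x in Omega) (f x * u x)| <=
    C * Nf f * (\int[leb2]_z (`|nl u z| `^ p)) `^ p^-1.
  move=> [Lf f0] U; have [[Lu u0] [Lnu _]] := U.
  rewrite Rintegral_vanish; last by move=> x /f0 ->; rewrite mul0r.
  under eq_Rintegral do rewrite mulrC.
  apply: le_trans (hoelder_Rintegral p1 pq Lu Lf) _.
  rewrite -Lfun_fine_Lnorm ?gt_eqF ?(lt_trans ltr01)// -/(Nf f) mulrAC ler_wpM2r//.
    by rewrite fine_ge0// Lnorm_ge0.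
  by rewrite -lee_fin EFinM !fineK ?Lfun_Lnorm_fin//; exact: Hpoin dd _ U.
have Lf21 : Lp_on (lebesgue_rV R n) Omega q%:E (f2 \- f1).
  have [[L1 z1] [L2 z2]] := (Lf1, Lf2); split; first exact: LfunB (ltW q1) L2 L1.
  by move=> x Ox; rewrite /= z1// z2// subrr.
(* The divergence is the negative adjoint, hence the minus sign: representing this functional by
   [sigma] is the same as [sigma] having divergence [f2]. As a relation, [G] does not require [u] to
   be recovered from its gradient. *)
pose G : set (('rV[R]_n * 'rV[R]_n -> R) * R) :=
  [set z | exists2 u, U0 Omega p delta w u &
    z = (nl u, - \int[lebesgue_rV R n]_(x in Omega) (f2 x * u x))].
have iO f u : Lp_on (lebesgue_rV R n) Omega q%:E f -> U0 Omega p delta w u ->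
    (lebesgue_rV R n).-integrable setT (EFin \o (fun x => f x * u x)).
  move=> [Lf _] [[Lu _] _]; have := Lfun_mul_integrable p1 pq Lu Lf.
  by apply: eq_integrable => // x _ /=; rewrite mulrC.
have OE f u : Lp_on (lebesgue_rV R n) Omega q%:E f ->
    \int[lebesgue_rV R n]_(x in Omega) (f x * u x) =
    \int[lebesgue_rV R n]_x (f x * u x).
  by move=> [_ f0]; apply: Rintegral_vanish => x /f0 ->; rewrite mul0r.
have G0 : G !=set0.
  exists (nl (fun=> 0), - \int[lebesgue_rV R n]_(x in Omega) (f2 x * 0)).
  by exists (fun=> 0) => //; exact: U0_0 (ltW p1).
have Glin g l g' l' c : G (g, l) -> G (g', l') ->
    G (fun x => g x + c * g' x, l + c * l').
  move=> [u Uu [-> ->]] [v Uv [-> ->]]; exists (fun x => u x + c * v x).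
    exact: U0_linear (ltW p1) Uu Uv.
  congr (_, _); first by rewrite /nl nlgrad_linear.
  rewrite !OE// mulrN -RintegralZl//; last exact: iO.
  rewrite -opprD -RintegralD//; last 2 first.
  - exact: iO.
  - exact (integrableZl measurableT c (iO _ _ Lf2 Uv)).
  by congr (- _); apply: eq_Rintegral => x _; ring.
have GLp g l : G (g, l) -> g \in Lfun leb2 p%:E by move=> [u [_ []] + _ [-> _]].
have Gbnd g l : G (g, l) ->
    `|l| <= C * Nf f2 * (\int[leb2]_z (`|g z| `^ p)) `^ p^-1.
  by move=> [u Uu [-> ->]]; rewrite normrN; exact: bound.
have B0 : 0 <= C * Nf f2 by rewrite mulr_ge0 ?fine_ge0 ?Lnorm_ge0// ltW.
have [sigma [Ls sz EL cmp]] := dual_competitor p1 pq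
  (measurable_clamp klow kup mk) k0 (clamp_bnd _ klk) klk B0 G0 Glin GLp Gbnd.
have sz' z : ~ E2 z -> sigma z = 0.
  by move=> zE; apply: sz => g l [u _ [-> _]]; exact: nl0.
have Qs : Qf Omega p q delta w f2 sigma.
  split => // u Uu; rewrite [in RHS]Rintegral_vanish; last first.
    by move=> z zE; rewrite (sz' _ zE) mul0r.
  by rewrite (EL (nl u) _ (ex_intro2 _ _ u Uu erefl)) opprK.
apply: le_trans (min2 _ Qs) _.
have Ls' : Lp_on leb2 E2 q%:E sigma by [].
rewrite (energy_clamp klk k0 q1 mk aek Ls') (energy_clamp klk k0 q1 mk aek Ls1).
have [Lf21' _] := Lf21.
rewrite -(fineK (Lfun_Lnorm_fin Lf21')) -EFinM -EFinD lee_fin -/(Nf _) -/(Nf _).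
have [Ls1' s10] := Ls1.
apply: le_trans (cmp s1 (C * Nf (f2 \- f1)) Ls1' _ _) _.
- by rewrite mulr_ge0 ?fine_ge0 ?Lnorm_ge0// ltW.
- move=> g l [u Uu [-> _]].
  have Lnu : nl u \in Lfun leb2 p%:E by have [_ []] := Uu.
  (* The divergences of [sigma] and [s1] are [f2] and [f1], so against a gradient only their
     difference survives. *)
  have -> : \int[leb2]_z (nl u z * (sigma z - s1 z)) =
      - \int[lebesgue_rV R n]_(x in Omega) ((f2 \- f1) x * u x).
    have Esigma : \int[leb2]_z (nl u z * sigma z) =
        - \int[lebesgue_rV R n]_(x in Omega) (f2 x * u x).
      rewrite -(EL (nl u) _ (ex_intro2 _ _ u Uu erefl)).
      by apply: eq_Rintegral => z _; rewrite mulrC.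
    have Es1 : \int[leb2]_z (nl u z * s1 z) =
        - \int[lebesgue_rV R n]_(x in Omega) (f1 x * u x).
      rewrite div1// opprK [in RHS]Rintegral_vanish.
        by apply: eq_Rintegral => z _; rewrite mulrC.
      by move=> z zE; rewrite (s10 _ zE) mul0r.
    under eq_Rintegral do rewrite mulrBr.
    rewrite RintegralB//; [|exact: Lfun_mul_integrable p1 pq Lnu Ls
                           |exact: Lfun_mul_integrable p1 pq Lnu Ls1'].
    rewrite Esigma Es1 (OE _ _ Lf21) !OE//.
    under [in RHS]eq_Rintegral do rewrite /= mulrBl.
    by rewrite RintegralB//; [rewrite opprB opprK addrC|exact: iO..].
  by rewrite normrN; exact: bound.
rewrite lerD2l /stability_const [leRHS]mulrAC; apply: ler_wpM2l.
  by rewrite mulr_ge0 ?fine_ge0 ?Lnorm_ge0// ltW.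
(* Minkowski with |f2 - f1|_q < 1 removes [f2] from the constant; this is the origin of [t + 1]. *)
have Nle : Nf f2 <= Nf f1 + 1.
  have [[L1 _] [L2 _]] := (Lf1, Lf2).
  have -> : Nf f2 = Nf (f1 \+ (f2 \- f1)).
    by congr (fine (Lnorm _ _ _)); apply/funext => x; rewrite /= addrC subrK.
  rewrite -lee_fin EFinD /Nf !fineK ?Lfun_Lnorm_fin//; last first.
    by apply: LfunD => //; exact: ltW.
  apply: le_trans (minkowski_EFin _ (Lfun_measurable L1)
    (Lfun_measurable Lf21') (ltW q1)) _.
  by apply: leeD => //; exact: ltW.
have Nf0 f : 0 <= Nf f by rewrite fine_ge0// Lnorm_ge0.
apply: ge0_ler_powR; rewrite ?nnegrE ?subr_ge0 ?(ltW q1)//.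
- by rewrite divr_ge0// ltW.
- by rewrite divr_ge0 ?mulr_ge0 ?addr_ge0// ltW.
- by rewrite ler_wpM2r ?invr_ge0 ?(ltW k0)// ler_wpM2l// ltW.
Qed.
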